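(* Let $a,c$ be nonzero complex numbers and let $\ell,m,n$ be nonnegative integers with $m\le n$. Then $$ {}_4\phi_3\left[\begin{matrix}a,\,c,\,q^{-n},\,-q^{1+\ell-m+n}a/c\\ q^{1+\ell}a/c,\,q^{1-m+n}a,\,-q^{-n}c\end{matrix};q,q\right] =\frac{(a,\,-q^{-\ell}c;q)_\ell}{(q^{-\ell-1}c^2,\,-qa/c;q)_\ell}\, \frac{(q^{1-m+n},\,-qa/c;q)_n}{(q^{1-m+n}a,\,-q/c;q)_n}\sum_{i=0}^{\ell}\sum_{j=0}^{m}T_{i,j}, $$ where $$ T_{i,j}=(-1)^{i}q^{(m-n)j+\binom{j+1}{2}}\Big(\frac{c}{a}\Big)^i\,\frac{1-q^{1+2i}/c^2}{1-q/c^2}\, \frac{(q^{-\ell},\,q^{1+\ell}a/c^2,\,q/c^2;q)_i}{(q,\,q^{1-\ell}/a,\,q^{2+\ell}/c^2;q)_i} $$ $$ \times\frac{(q^{-m},\,q^{-n},\,-q^{-n},\,q^{\ell-i}a,\,q^{1+\ell+i}a/c^2;q)_j}{(q,\,q^{1+\ell}a/c,\,-q^{1+\ell}a/c,\,q^{m-2n},\,q^{j-2n-1};q)_j}\, \frac{(q^{1+\ell-i+j}a,\,q^{2+\ell+i+j}a/c^2;q^2)_{n-j}}{(q,\,q^{2+2\ell+2j}a^2/c^2;q^2)_{n-j}}. $$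
   Context: $q$ is a nonzero complex number. For complex $x$ and an integer $n\ge 0$, the $q$-shifted factorial is $(x;q)_0=1$, $(x;q)_n=\prod_{k=0}^{n-1}(1-xq^k)$, and $(x_1,\dots,x_r;q)_n=\prod_{s=1}^r (x_s;q)_n$ (likewise with base $q^2$ in place of $q$). The basic hypergeometric series is ${}_4\phi_3\left[\begin{matrix}a_0,a_1,a_2,a_3\\ b_1,b_2,b_3\end{matrix};q,z\right]=\sum_{k\ge0}\frac{(a_0,a_1,a_2,a_3;q)_k}{(q,b_1,b_2,b_3;q)_k}z^k$. Here one upper parameter is $q^{-n}$, so the series terminates and means the sum over $0\le k\le n$. Parameters are assumed to be such that no zero factor appears in a denominator of the displayed expressions. *)

(* Defs.v *)
From mathcomp Require Import all_boot all_order all_algebra.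
From mathcomp Require Import reals.
From mathcomp.real_closed Require Export complex.

Set Implicit Arguments.
Unset Strict Implicit.
Unset Printing Implicit Defensive.

Import GRing.Theory.
Local Open Scope ring_scope.

Section QSeries.
Variable F : fieldType.
Implicit Types (x q z a c : F) (xs : seq F).

Definition qpoch x q (n : nat) : F := \prod_(k < n) (1 - x * q ^+ k).

Definition qpochs xs q (n : nat) : F := \prod_(x <- xs) qpoch x q n.

(* The sum stops at k = N; this is the whole series when q ^ (- N) is one of
   the upper parameters. *)
Definition phi43 (N : nat) (a0 a1 a2 a3 b1 b2 b3 q z : F) : F :=
  \sum_(k < N.+1)
    qpochs [:: a0; a1; a2; a3] q k / qpochs [:: q; b1; b2; b3] q k * z ^+ k.

(* Exponents of q are integers ([exprz]): every subtraction is in int. *)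
Definition Tterm q a c (l m n i j : nat) : F :=
  (-1) ^+ i * q ^ ((m%:Z - n%:Z) * j%:Z + 'C(j.+1, 2)%:Z) * (c / a) ^+ i
  * ((1 - q ^+ (1 + 2 * i) / c ^+ 2) / (1 - q / c ^+ 2))
  * (qpochs [:: q ^ (- l%:Z); q ^+ (1 + l) * a / c ^+ 2; q / c ^+ 2] q i
     / qpochs [:: q; q ^ (1 - l%:Z) / a; q ^+ (2 + l) / c ^+ 2] q i)
  * (qpochs [:: q ^ (- m%:Z); q ^ (- n%:Z); - q ^ (- n%:Z);
                q ^ (l%:Z - i%:Z) * a; q ^+ (1 + l + i) * a / c ^+ 2] q j
     / qpochs [:: q; q ^+ (1 + l) * a / c; - (q ^+ (1 + l) * a / c);
                  q ^ (m%:Z - 2 * n%:Z); q ^ (j%:Z - 2 * n%:Z - 1)] q j)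
  * (qpochs [:: q ^ (1 + l%:Z - i%:Z + j%:Z) * a;
                q ^+ (2 + l + i + j) * a / c ^+ 2] (q ^+ 2) (n - j)
     / qpochs [:: q; q ^+ (2 + 2 * l + 2 * j) * a ^+ 2 / c ^+ 2]
              (q ^+ 2) (n - j)).

End QSeries.

(* Main.v *)
Require Import Defs.
From mathcomp Require Import all_boot all_order all_algebra.
From mathcomp Require Import reals ring zify.

Import GRing.Theory.
Local Open Scope ring_scope.

(** Sears' transformation turns the balanced 4phi3 of the statement into one
    whose k-th term is, up to constants, (q^-n, -q^(m-n))_k / (q^(m-2n))_k times
    (a, q^(1+l)a/c^2)_k / (d, -qa/c)_k, with d = q^(1+l)a/c.  The terminating
    6phi5 sum is then read backwards, twice.
    With base parameter q/c^2 it expands (a, q^(1+l)a/c^2, -d)_k / (-qa/c)_k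
    into the products (u, v)_k, u = q^(l-i)a and v = q^(1+l+i)a/c^2, for which
    q u v = d^2.  With base parameter q^(-2n-1) it expands the first factor into
    the same factor with m = 0 and n - j, k - j in place of n, k.  The inner sum
    over k is then Andrews' terminating q-Watson sum.

    The hypotheses allow 1 - q^e = 0 for some even e in [n+1, 2n-2m], so
    1 / (q^(m-2n))_k cannot be formed.  All the sums are therefore stated with
    denominators cleared, using reversed products like (q^(1-m+n))_(n-k). *)

(** * Quadratic exponents and reindexing of double sums *)

Section Auxiliary.
Set Implicit Arguments.
Unset Strict Implicit.

Lemma binD2 (i j : nat) : 'C(i + j, 2) = ('C(i, 2) + 'C(j, 2) + i * j)%N.
Proof. by elim: i => [|i IH]; rewrite ?add0n ?mul0n ?addn0 // addSn !binS !bin1; lia. Qed.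

Lemma sqr_bin2 (j : nat) : (j * j = 'C(j, 2) + 'C(j, 2) + j)%N.
Proof. by elim: j => [|j IH] //; rewrite !binS !bin1; lia. Qed.

Lemma sum_triangle (V : nmodType) (n : nat) (f : nat -> nat -> V) :
  \sum_(k < n.+1) \sum_(j < k.+1) f k j
  = \sum_(j < n.+1) \sum_(i < (n - j).+1) f (j + i)%N j.
Proof.
elim: n => [|n IH]; first by rewrite !big_ord1.
rewrite big_ord_recr /= IH [RHS]big_ord_recr /= subnn big_ord1 addn0.
rewrite [X in _ + X = _]big_ord_recr /= addrA; congr (_ + _).
rewrite -big_split; apply: eq_bigr => j _ /=.
by rewrite subSn ?leq_ord // [RHS]big_ord_recr /= addnS subnKC ?leq_ord.
Qed.

(** Naming the third part p of n settles every difference that occurs in the triangle j + i <= n, so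
    that no truncated subtraction is left in [sears_transformation]. *)
Lemma nat_split3 (n j i : nat) : (j <= n)%N -> (i <= n - j)%N ->
  exists p, [/\ n = (j + i + p)%N, (n - j - i = p)%N, (j + i - j = i)%N,
    (n - (j + i) = p)%N & (n - j = i + p)%N].
Proof. by move=> le_jn le_in; exists (n - j - i)%N; split; lia. Qed.

Lemma muln_split3 (n j i p : nat) : n = (j + i + p)%N ->
  (n * (j + i) = n * j + (i * j + (i + p) * i))%N.
Proof. by move=> ->; lia. Qed.

Lemma sum_shift (V : nmodType) (n j : nat) (f : nat -> V) : (j <= n)%N ->
  \sum_(k < n.+1) (if (j <= k)%N then f k else 0)
  = \sum_(i < (n - j).+1) f (j + i)%N.
Proof.
move=> le_jn; rewrite -(big_mkord predT (fun k => if (j <= k)%N then f k else 0)).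
rewrite (@big_cat_nat _ _ _ j) //=; last by rewrite ltnW.
rewrite big_nat_cond big1 ?add0r => [|k]; last first.
  by rewrite andbT => /andP[_ lt_kj]; rewrite leqNgt lt_kj.
rewrite -{1}[j]add0n big_addn big_mkord subSn //.
by apply: eq_bigr => i _; rewrite leq_addl addnC.
Qed.

End Auxiliary.

(** * Splitting and nonvanishing of q-shifted factorials *)

Section QSeriesTheory.
Set Implicit Arguments.
Unset Strict Implicit.
Variable F : fieldType.
Implicit Types (x y z q u v a b c d e f g A : F).

Lemma qpoch0 x q : qpoch x q 0 = 1.
Proof. by rewrite /qpoch big_ord0. Qed.

Lemma qpochS x q k : qpoch x q k.+1 = qpoch x q k * (1 - x * q ^+ k).
Proof. by rewrite /qpoch big_ord_recr. Qed.

Lemma qpochSl x q k : qpoch x q k.+1 = (1 - x) * qpoch (x * q) q k.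
Proof.
rewrite /qpoch big_ord_recl expr0 mulr1; congr (_ * _).
by apply: eq_bigr => i _; rewrite /= exprS mulrA.
Qed.

Lemma qpochD x q k p : qpoch x q (k + p) = qpoch x q k * qpoch (x * q ^+ k) q p.
Proof.
elim: k x => [|k IH] x; first by rewrite qpoch0 mul1r expr0 mulr1.
by rewrite addSn !qpochSl IH exprS mulrA mulrA.
Qed.

Lemma qpoch_neq0P x q k :
  reflect (forall t, (t < k)%N -> 1 - x * q ^+ t != 0) (qpoch x q k != 0).
Proof.
apply: (iffP idP) => [|h].
  by move=> /prodf_neq0 h t lt_tk; apply: (h (Ordinal lt_tk)).
by apply/prodf_neq0 => i _; apply: h.
Qed.

Lemma qpoch_neq0W x q k p : (k <= p)%N -> qpoch x q p != 0 -> qpoch x q k != 0.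
Proof.
by move=> le_kp /qpoch_neq0P h; apply/qpoch_neq0P => t ltk; apply: h; apply: leq_trans le_kp.
Qed.

(** * Terminating summation formulas by telescoping *)

(** The Gaussian binomial coefficient as a quotient. It is meant for k <= n and a nonzero (q)_n. *)
Definition qbin q (n k : nat) : F :=
  qpoch q q n / (qpoch q q k * qpoch q q (n - k)).

(** The induction step of the Wilf-Zeilberger method: f is the summand for n + 1, g the summand for
    n, and rho the ratio of the two closed forms. The top term j = n + 1 has no counterpart in g, so
    it is kept out of the recurrence and cancels the last value of the certificate G. *)
Lemma sum_telescope_step (f g G : nat -> F) (rho : F) (n : nat) :
    (forall j, (j <= n)%N -> f j = rho * g j + (G j.+1 - G j)) ->
    G 0 = 0 -> f n.+1 = - G n.+1 ->
  \sum_(j < n.+2) f j = rho * \sum_(j < n.+1) g j.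
Proof.
move=> fE G0 fn; rewrite big_ord_recr /= fn mulr_sumr.
rewrite (eq_bigr (fun j : 'I_n.+1 => rho * g j + (G j.+1 - G j))) => [|j _].
  rewrite big_split /= -(big_mkord predT (fun j => G j.+1 - G j)) telescope_sumr //.
  by rewrite G0 subr0 addrK.
by apply: fE; rewrite -ltnS.
Qed.

(* Dividing by (bcg)_k gives the usual balanced 3phi2 with upper parameters
   q^-k, b, c and lower parameter bcg.  G is the Wilf-Zeilberger certificate. *)
Lemma q_saalschuetz q b c g (k : nat) : qpoch q q k != 0 ->
  \sum_(j < k.+1) qbin q k j * g ^+ j * qpoch b q j * qpoch c q j
      * qpoch (b * c * g * q ^+ j) q (k - j) * qpoch g q (k - j)
  = qpoch (b * g) q k * qpoch (c * g) q k.
Proof.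
elim: k => [|k IH] qk.
  by rewrite big_ord1 /qbin /= !subnn !qpoch0 expr0 !mulr1 divr1.
have qk' := qpoch_neq0W (leqnSn k) qk.
pose f k j := qbin q k j * g ^+ j * qpoch b q j * qpoch c q j
      * qpoch (b * c * g * q ^+ j) q (k - j) * qpoch g q (k - j).
pose G j := if j is i.+1 then - (qbin q k i * q ^+ (k - i) * g ^+ i.+1
   * qpoch b q i.+1 * qpoch c q i.+1 * qpoch (b * c * g * q ^+ i) q (k - i)
   * qpoch g q (k - i)) else 0.
rewrite (sum_telescope_step (f := f k.+1) (g := f k) (G := G)
  (rho := (1 - b * g * q ^+ k) * (1 - c * g * q ^+ k))) //.
- by rewrite /f IH // !qpochS; ring.
- move=> [|j] le_jk; rewrite /f /G.
    rewrite /qbin !subn0 !qpochS !qpoch0 !expr0 expr1 !mulr1.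
    field.
    by rewrite -negb_or -mulf_eq0 -qpochS.
  (* With k = j + 1 + p all differences become sums, and what remains is a rational identity in q^j
     and q^p. The case j = 0 stood apart because G vanishes there by definition. *)
  have [p kE] : exists p, k = (j.+1 + p)%N by exists (k - j.+1)%N; lia.
  have e1 : (k.+1 - j.+1 = p.+1)%N by lia.
  have e2 : (k - j.+1 = p)%N by lia.
  have e3 : (k - j = p.+1)%N by lia.
  rewrite /qbin e1 e2 e3.
  have q1 := qpoch_neq0W le_jk qk'.
  have q2 : qpoch q q p.+1 != 0 by apply: qpoch_neq0W qk'; lia.
  move: qk qk' q1 q2; rewrite !(qpochS q q) !(qpochS b q) !(qpochS c q) !(qpochS g q).
  rewrite [qpoch (_ * q ^+ j) q p.+1]qpochSl [qpoch (_ * q ^+ j.+1) q p.+1]qpochS.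
  set Q := qpoch q q k.
  rewrite kE !exprD !exprS -!mulrA [q ^+ j * q]mulrC.
  set X := qpoch (b * _) q p; set x := q ^+ j; set z := q ^+ p.
  rewrite !mulf_eq0 !negb_or => /andP[qk qk1] _ /andP[qj qj1] /andP[qp qp1].
  field.
  by rewrite qj qp qj1 qp1.
rewrite /f /G /qbin !subnn !qpoch0 !expr0; field.
by rewrite qk qk'.
Qed.

Lemma qpochSX x q i k :
  qpoch (x * q ^+ i) q k.+1 = (1 - x * q ^+ i) * qpoch (x * q ^+ i.+1) q k.
Proof. by rewrite qpochSl exprSr mulrA. Qed.

(* In the usual notation the parameters are A, A q / y, 1 / d, q^-l.  The
   induction on l replaces A and y by A q and y q. *)
Lemma q_six_phi_five q A y d (l : nat) :
    qpoch q q l != 0 ->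
    (forall s, (0 < s < l.*2)%N -> 1 - A * q ^+ s != 0) ->
  \sum_(j < l.+1) qbin q l j * q ^+ 'C(j, 2)
      * (\prod_(t < j) ((q ^+ t - d) * (y - A * q ^+ t.+1)))
      * qpoch (A * d * q ^+ j.+1) q (l - j) * qpoch (y * q ^+ j) q (l - j)
      / (qpoch (A * q ^+ j) q j * qpoch (A * q ^+ j.*2.+1) q (l - j))
  = qpoch (y * d) q l.
Proof.
elim: l A y => [|l IH] A y qk HA.
  by rewrite big_ord1 /qbin /= !subnn big_ord0 !qpoch0 expr0 !(mulr1, divr1).
have qk' := qpoch_neq0W (leqnSn l) qk.
pose W j : F := \prod_(t < j) ((q ^+ t - d) * (y - A * q ^+ t.+1)).
have WS j : W j.+1 = W j * ((q ^+ j - d) * (y - A * q ^+ j.+1)).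
  by rewrite /W big_ord_recr.
pose f j := qbin q l.+1 j * q ^+ 'C(j, 2) * W j
      * qpoch (A * d * q ^+ j.+1) q (l.+1 - j) * qpoch (y * q ^+ j) q (l.+1 - j)
      / (qpoch (A * q ^+ j) q j * qpoch (A * q ^+ j.*2.+1) q (l.+1 - j)).
(* The summand for l at A q and y q: each factor y q - A q q^(t+1) releases one q, whence q^j in
   front of [W j]. *)
pose g j := qbin q l j * q ^+ 'C(j, 2) * (q ^+ j * W j)
      * qpoch (A * d * q ^+ j.+2) q (l - j) * qpoch (y * q ^+ j.+1) q (l - j)
      / (qpoch (A * q ^+ j.+1) q j * qpoch (A * q ^+ j.*2.+2) q (l - j)).
pose G j := if j is i.+1 then - (qbin q l i * q ^+ 'C(i, 2) * (q ^+ i * W i.+1)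
      * qpoch (A * d * q ^+ i.+2) q (l - i) * qpoch (y * q ^+ i.+1) q (l - i)
      / (qpoch (A * q ^+ i.+1) q i.+1 * qpoch (A * q ^+ i.*2.+2) q (l - i))) else 0.
have HA1 s : (0 < s < l.*2)%N -> 1 - A * q * q ^+ s != 0.
  by move=> Hs; rewrite -mulrA -exprS; apply: HA; lia.
have HA2 s k : (0 < s)%N -> (s + k <= l.*2.+2)%N -> qpoch (A * q ^+ s) q k != 0.
  move=> s_gt0 le_skl; apply/qpoch_neq0P => t lt_tk.
  by rewrite -mulrA -exprD; apply: HA; lia.
rewrite (sum_telescope_step (f := f) (g := g) (G := G) (rho := 1 - y * d)) //.
- rewrite qpochSl; congr (_ * _).
  have -> : y * d * q = y * q * d by ring.
  rewrite -(IH (A * q) (y * q)) //; apply: eq_bigr => j _; rewrite /g /W.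
  have -> : \prod_(t < j) ((q ^+ t - d) * (y * q - A * q * q ^+ t.+1)) =
      q ^+ j * \prod_(t < j) ((q ^+ t - d) * (y - A * q ^+ t.+1)).
    rewrite -[X in q ^+ X](card_ord j) -prodr_const -big_split /=.
    by apply: eq_bigr => t _; ring.
  by rewrite !(exprS q (_.+1)) !(exprS q j) !(exprS q j.*2) !mulrA -!(mulrAC A d q).
- move=> [|j] le_jl.
    rewrite /f /g /G /qbin !subn0 !WS !double0 /W big_ord0 !expr0.
    rewrite [qpoch (A * d * _) q l.+1]qpochSl [qpoch (y * _) q l.+1]qpochSl.
    rewrite [qpoch (A * q ^+ 1) q l.+1]qpochSl (qpochS _ q 0) !qpoch0 !expr1 !mulr1.
    rewrite -!(mulrA _ q q) -!expr2 !(mulrAC A d).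
    have h1 := HA2 2%N l isT ltac:(lia); have h2 := HA2 1%N 1%N isT ltac:(lia).
    move: h2; rewrite qpochS qpoch0 mul1r expr0 mulr1 expr1 => h2.
    by field; rewrite qk qk' h1 h2.
  have [p lE] : exists p, l = (j.+1 + p)%N by exists (l - j.+1)%N; lia.
  have e1 : (l.+1 - j.+1 = p.+1)%N by lia.
  have e2 : (l - j.+1 = p)%N by lia.
  have e3 : (l - j = p.+1)%N by lia.
  rewrite /f /g /G /qbin e1 e2 e3 !WS.
  have q1 := qpoch_neq0W le_jl qk'.
  have q2 : qpoch q q p.+1 != 0 by apply: qpoch_neq0W qk'; lia.
  have h1 := HA2 j.*2.+2 p.+2 isT ltac:(lia).
  have h2 := HA2 j.+1 j.+2 isT ltac:(lia).
  have h3 : 1 - A * q ^+ (j.*2.+2 + p.+1) != 0 by apply: HA; lia.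
  rewrite !binS !bin1 doubleS.
  (* The products to be compared start at exponents 2j+2, 2j+3 and 2j+4. All are written through the
     one starting at 2j+4, at the price of dividing by its last factor. *)
  have e4 : qpoch (A * q ^+ j.*2.+2) q p.+1 =
      (1 - A * q ^+ j.*2.+2) * (1 - A * q ^+ j.*2.+3)
      * qpoch (A * q ^+ j.*2.+4) q p / (1 - A * q ^+ (j.*2.+2 + p.+1)).
    by apply: (canRL (mulfK h3)); rewrite exprD mulrA -qpochS !qpochSX mulrA.
  rewrite e4 (qpochSX A q j.+1 j) !(qpochS (A * q ^+ j.+2)).
  rewrite (qpochSX A q j.*2.+3) (qpochSX (A * d)) (qpochSX y).
  move: qk qk' q1 q2 h1 h2 h3.
  rewrite (qpochSX A q j.+1) (qpochSX A q j.*2.+2) (qpochSX A q j.*2.+3).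
  rewrite !(qpochS q q) !(qpochS (A * q ^+ j.+2)).
  set Q := qpoch q q l. set V := qpoch (A * q ^+ j.+2) q j.
  set U := qpoch (A * q ^+ j.*2.+4) q p.
  set Y := qpoch (y * _) q p. set D := qpoch (A * d * _) q p.
  rewrite lE !exprD !exprS -addnn exprD.
  set x := q ^+ j; set z := q ^+ p; set c := q ^+ 'C(j, 2).
  rewrite !mulf_eq0 !negb_or => /andP[qk qk1] _ /andP[qj qj1] /andP[qp qp1].
  move=> /and3P[hA1 hA2 hU] /and3P[hA3 hV _] hA4.
  by field; rewrite hA1 hA2 hA3 hA4 hU hV qj qp qj1 qp1.
rewrite /f /G /qbin !subnn !qpoch0 binS bin1 exprD; field.
by rewrite qk qk' HA2 //; lia.
Qed.

(** Divided by (q^(n+1))_n (quv; q^2)_n, the sum is the 4phi3 with upper parameters q^-n, -q^-n, u,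
    v, lower parameters q^(-2n) and the two square roots of quv, and argument q. The certificate G
    is a rational multiple of the summand for n. *)
Lemma andrews_q_watson q u v (n : nat) : qpoch q q n != 0 ->
  \sum_(k < n.+1) qbin q n k * q ^+ 'C(k.+1, 2)
      * qpoch (- q ^+ (n - k).+1) q k * qpoch (q ^+ n.+1) q (n - k)
      * qpoch u q k * qpoch v q k * qpoch (u * v * q ^+ k.*2.+1) (q ^+ 2) (n - k)
  = qpoch (- q) q n * qpoch (q * u) (q ^+ 2) n * qpoch (q * v) (q ^+ 2) n.
Proof.
elim: n => [|n IH] qn.
  by rewrite big_ord1 /qbin /= !subnn !qpoch0 expr0 !mulr1 divr1.
have qn' := qpoch_neq0W (leqnSn n) qn.
pose f n k := qbin q n k * q ^+ 'C(k.+1, 2)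
      * qpoch (- q ^+ (n - k).+1) q k * qpoch (q ^+ n.+1) q (n - k)
      * qpoch u q k * qpoch v q k * qpoch (u * v * q ^+ k.*2.+1) (q ^+ 2) (n - k).
pose G k := if k is i.+1 then - ((1 + q ^+ n.+1) * q ^+ (n.*2.+1 - i)
   * (1 - u * q ^+ i) * (1 - v * q ^+ i) * f n i) else 0.
rewrite (sum_telescope_step (f := f n.+1) (g := f n) (G := G)
  (rho := (1 + q ^+ n.+1) * (1 - q ^+ n.*2.+1 * u) * (1 - q ^+ n.*2.+1 * v))) //.
- rewrite /f IH // !qpochS -!exprM mul2n !(exprS q); ring.
- move=> [|j] le_jn; rewrite /G /f.
    rewrite /qbin !subn0 !qpoch0 !expr0 !mulr1 double0 expr1.
    (* The base q^(n+1) moves with n: the factor 1 - q^(n+1) is lost, and 1 - q^(2n+1) and 1 -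
       q^(2n+2) are gained. *)
    have e : qpoch (q ^+ n.+2) q n.+1 = qpoch (q ^+ n.+1) q n
        * (1 - q ^+ n.*2.+1) * (1 + q ^+ n.+1).
      have h : 1 - q ^+ n.+1 != 0.
        by move: qn; rewrite qpochS mulf_eq0 negb_or -exprS => /andP[].
      apply: (mulfI h); rewrite [q ^+ n.+2]exprSr -qpochSl !qpochS -!exprD -!addnn.
      by rewrite !(exprS, exprD); ring.
    rewrite e !(qpochS (u * v * q)) -exprM mul2n !exprS.
    by field; rewrite qn' qn.
  have [p nE] : exists p, n = (j.+1 + p)%N by exists (n - j.+1)%N; lia.
  have e1 : (n.+1 - j.+1 = p.+1)%N by lia.
  have e2 : (n - j.+1 = p)%N by lia.
  have e3 : (n - j = p.+1)%N by lia.
  have e4 : (n.*2.+1 - j.+1 = j + (p + p).+2)%N by lia.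
  have e5 : (n.*2.+1 - j = j + (p + p).+3)%N by lia.
  rewrite /qbin e1 e2 e3 e4 e5.
  have q1 := qpoch_neq0W le_jn qn'.
  have q2 : qpoch q q p.+1 != 0 by apply: qpoch_neq0W qn'; lia.
  have h : 1 - q ^+ n.+1 != 0.
    by move: qn; rewrite qpochS mulf_eq0 negb_or -exprS => /andP[].
  have e : qpoch (q ^+ n.+2) q p.+1 = qpoch (q ^+ n.+1) q p
        * (1 - q ^+ n.+1 * q ^+ p) * (1 - q ^+ n.+1 * q ^+ p.+1) / (1 - q ^+ n.+1).
    by apply: (canRL (mulfK h)); rewrite mulrC [q ^+ n.+2]exprSr -qpochSl !qpochS.
  have ey : qpoch (- q ^+ p.+1) q j.+1 = (1 + q ^+ p.+1) * qpoch (- q ^+ p.+2) q j.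
    by rewrite qpochSl opprK mulNr -exprSr.
  rewrite e ey (qpochS (- q ^+ p.+2)) (qpochS (q ^+ n.+1)) (qpochS _ (q ^+ 2)).
  have ew : qpoch (u * v * q ^+ j.*2.+1) (q ^+ 2) p.+1 =
      (1 - u * v * q ^+ j.*2.+1) * qpoch (u * v * q ^+ j.+1.*2.+1) (q ^+ 2) p.
    by rewrite qpochSl -[_ * q ^+ 2]mulrA -exprD addn2 doubleS.
  rewrite ew !(qpochS u) !(qpochS v) (binS j.+1 1) bin1 [q ^+ ('C(_, _) + _)]exprD.
  move: qn qn' q1 q2 h; rewrite !(qpochS q q).
  set Q := qpoch q q n; set W := qpoch (u * v * _) _ p.
  set Y := qpoch (- q ^+ _) q j; set Z := qpoch (q ^+ _) q p.
  set c := q ^+ 'C(_, _).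
  rewrite -exprM mul2n nE -!addnn !(exprD, exprS).
  set x := q ^+ j; set z := q ^+ p.
  rewrite !mulf_eq0 !negb_or => /andP[qk qk1] _ /andP[qj qj1] /andP[qp qp1] h.
  by field; rewrite h qj qp qj1 qp1.
rewrite /f /G /f /qbin !subnn !qpoch0 (binS n.+1 1) bin1.
rewrite (_ : n.*2.+1 - n = n.+1)%N; last lia.
rewrite expr1 !(qpochS u) !(qpochS v) (qpochS (- q)) exprD !(exprS q n).
by field; rewrite qn qn'.
Qed.

(** * Reversal of products and Sears' transformation *)

Lemma prod_expr_bin q k : \prod_(t < k) q ^+ t = q ^+ 'C(k, 2).
Proof.
by elim: k => [|k IH]; rewrite ?big_ord0 // big_ord_recr IH binS bin1 exprD.
Qed.

(** The hypothesis says y = q^(1-k) / x without negative powers. The factor number t on the left is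
    then matched with number k - 1 - t on the right. *)
Lemma qpoch_rev q x y k : q != 0 -> x * y * q ^+ k = q ->
  qpoch x q k = (- x) ^+ k * q ^+ 'C(k, 2) * qpoch y q k.
Proof.
move=> q0 xy; case: k xy => [|k] xy; first by rewrite !qpoch0 !expr0 !mulr1.
have {}xy : x * y * q ^+ k = 1.
  by apply: (mulfI q0); rewrite mulr1 mulrCA -exprS.
rewrite -prod_expr_bin -[X in (- x) ^+ X]card_ord -prodr_const -big_split /=.
rewrite [X in _ * X](reindex_inj rev_ord_inj) -big_split /=.
apply: eq_bigr => t _; rewrite subSS.
have h : q ^+ k = q ^+ (k - t) * q ^+ t by rewrite -exprD subnK // leq_ord.
by transitivity (x * y * q ^+ k - x * q ^+ t); [rewrite xy | rewrite h; ring].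
Qed.

Lemma qbin_qpoch q n k : q != 0 -> qpoch q q n != 0 -> (k <= n)%N ->
  qpoch (q ^+ n)^-1 q k / qpoch q q k
  = qbin q n k * (-1) ^+ k * q ^+ 'C(k, 2) / q ^+ (n * k).
Proof.
move=> q0 qn le_kn.
have qk := qpoch_neq0W le_kn qn.
have [p nE] : exists p, n = (p + k)%N by exists (n - k)%N; lia.
rewrite (@qpoch_rev _ _ (q ^+ p.+1)) //; last first.
  by rewrite -mulrA -exprD addSn -nE exprSr mulKf // expf_neq0.
have e : qpoch q q n = qpoch q q p * qpoch (q ^+ p.+1) q k.
  by rewrite nE qpochD -exprS.
have np : (n - k = p)%N by lia.
rewrite /qbin np exprM [(- _^-1) ^+ k]exprNn exprVn; move: qn; rewrite e.
rewrite mulf_eq0 negb_or => /andP[qp qp1].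
by field; rewrite ?expf_neq0 ?qk ?qp ?q0.
Qed.

(** This is [q_saalschuetz] at g = e/(ab). The balancing condition becomes g f q^n = q, so that
    (g)_(n-k) and (ag)_n are reversals of (f q^k)_(n-k) and (f/a)_n; the constant (-g)^n q^C(n,2)
    collects the powers. *)
Lemma q_saalschuetz_phi32 q a b e f (n : nat) :
    q != 0 -> a != 0 -> b != 0 -> e != 0 -> qpoch q q n != 0 ->
    e * f * q ^+ n = a * b * q ->
  \sum_(k < n.+1) qbin q n k * (-1) ^+ k * q ^+ 'C(k, 2) * q ^+ k / q ^+ (n * k)
      * qpoch a q k * qpoch b q k
      * qpoch (e * q ^+ k) q (n - k) * qpoch (f * q ^+ k) q (n - k)
  = a ^+ n * qpoch (e / a) q n * qpoch (f / a) q n.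
Proof.
move=> q0 a0 b0 e0 qn ef.
pose g := e / (a * b).
have g0 : g != 0 by rewrite /g mulf_neq0 ?invr_neq0 ?mulf_neq0.
have gab : a * b * g = e by rewrite /g mulrCA divff ?mulr1 ?mulf_neq0.
have gf : g * f * q ^+ n = q.
  have ab0 : a * b != 0 by rewrite mulf_neq0.
  by apply: (mulfI ab0); rewrite -ef -gab; ring.
have H := q_saalschuetz a b g qn.
have c0 : (- g) ^+ n * q ^+ 'C(n, 2) != 0 by rewrite mulf_neq0 ?expf_neq0 ?oppr_eq0.
apply: (mulfI c0); rewrite mulr_sumr.
transitivity (qpoch (a * g) q n * qpoch (b * g) q n); last first.
  rewrite (_ : b * g = e / a); last by rewrite /g; field; rewrite a0.
  rewrite (@qpoch_rev _ (a * g) (f / a)) //; last by rewrite -[RHS]gf; field; rewrite a0.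
  by rewrite -mulrN exprMn; ring.
rewrite -H; apply: eq_bigr => k _; rewrite gab.
have le_kn := leq_ord k; move: (nat_of_ord k) le_kn => {}k le_kn.
have [p nE] : exists p, n = (k + p)%N by exists (n - k)%N; lia.
have np : (n - k = p)%N by lia.
rewrite np (@qpoch_rev q g (f * q ^+ k)) //; last by rewrite -[RHS]gf nE exprD; ring.
subst n; rewrite binD2 mulnDl sqr_bin2.
have s2 : (-1) ^+ k * (-1) ^+ k = 1 :> F by rewrite -expr2 sqrr_sign.
rewrite -[- g]mulN1r !exprMn !exprD -[RHS]mul1r -[X in _ = X * _]s2.
by rewrite (mulnC k p); field; rewrite !expf_neq0 ?mulf_neq0.
Qed.

(* The two q-Saalschuetz sums: the first expands (b)_k (c)_k / (d)_k, the second
   evaluates the sum over k after the interchange. *)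
Lemma sears_transformation q a b c d e f (n : nat) :
    q != 0 -> a != 0 -> b != 0 -> c != 0 -> d != 0 -> e != 0 ->
    qpoch q q n != 0 -> qpoch d q n != 0 -> qpoch e q n != 0 -> qpoch f q n != 0 ->
    d * e * f * q ^+ n = a * b * c * q ->
  \sum_(k < n.+1) qbin q n k * (-1) ^+ k * q ^+ 'C(k, 2) * q ^+ k / q ^+ (n * k)
      * (qpoch a q k * qpoch b q k * qpoch c q k)
      / (qpoch d q k * qpoch e q k * qpoch f q k)
  = (qpoch e q n * qpoch f q n)^-1
    * \sum_(k < n.+1) qbin q n k * (-1) ^+ k * q ^+ 'C(k, 2) * q ^+ k / q ^+ (n * k)
      * qpoch a q k * (b * c / d) ^+ k * (qpoch (d / b) q k * qpoch (d / c) q k)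
      / qpoch d q k * (a * q ^+ k) ^+ (n - k)
      * qpoch (e / a) q (n - k) * qpoch (f / a) q (n - k).
Proof.
move=> q0 a0 b0 c0 d0 e0 qn dn en fn defabc.
(* The value for which (d/c)(d/b) g = d, (d/c) g = b and (d/b) g = c: [q_saalschuetz] then expands
   (b)_k (c)_k. *)
pose g := b * c / d.
have gE : d / c * (d / b) * g = d by rewrite /g; field; rewrite b0 c0 d0.
have g0 : g != 0 by rewrite /g !mulf_neq0 ?invr_neq0.
pose h n k := qbin q n k * (-1) ^+ k * q ^+ 'C(k, 2) * q ^+ k / q ^+ (n * k).
pose T k j := h n k * qpoch a q k / (qpoch d q k * qpoch e q k * qpoch f q k)
  * (qbin q k j * g ^+ j * qpoch (d / c) q j * qpoch (d / b) q j
      * qpoch (d * q ^+ j) q (k - j) * qpoch g q (k - j)).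
transitivity (\sum_(k < n.+1) \sum_(j < k.+1) T k j).
  apply: eq_bigr => k _; rewrite -mulr_sumr.
  have qk : qpoch q q k != 0 by apply: qpoch_neq0W qn; exact: leq_ord.
  have := q_saalschuetz (d / c) (d / b) g qk; rewrite gE => ->.
  rewrite (_ : d / c * g = b); last by rewrite /g; field; rewrite c0 d0.
  rewrite (_ : d / b * g = c); last by rewrite /g; field; rewrite b0 d0.
  by rewrite /h; ring.
rewrite (sum_triangle n T) mulr_sumr; apply: eq_bigr => j _.
have le_jn := leq_ord j; move: (nat_of_ord j) le_jn => {}j le_jn.
have qnj : qpoch q q (n - j) != 0 by apply: qpoch_neq0W qn; lia.
have aj0 : a * q ^+ j != 0 by rewrite mulf_neq0 ?expf_neq0.
have ej0 : e * q ^+ j != 0 by rewrite mulf_neq0 ?expf_neq0.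
(* The inner sum over i = k - j has upper parameters a q^j and g, lower parameters e q^j and f q^j,
   and length n - j. It is balanced because the outer series is. *)
have Hin : e * q ^+ j * (f * q ^+ j) * q ^+ (n - j) = a * q ^+ j * g * q.
  have -> : e * q ^+ j * (f * q ^+ j) * q ^+ (n - j) = e * f * q ^+ n * q ^+ j.
    by rewrite -{2}(subnK le_jn) exprD; ring.
  have -> : e * f * q ^+ n = a * b * c * q / d by rewrite -defabc; field.
  by rewrite /g; field.
have Hs := q_saalschuetz_phi32 q0 aj0 g0 ej0 qnj Hin.
rewrite (_ : e * q ^+ j / (a * q ^+ j) = e / a) in Hs; last by field; rewrite a0 expf_neq0.
rewrite (_ : f * q ^+ j / (a * q ^+ j) = f / a) in Hs; last by field; rewrite a0 expf_neq0.
pose K := h n j * qpoch a q j * g ^+ j * (qpoch (d / b) q j * qpoch (d / c) q j)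
  / qpoch d q j / (qpoch e q n * qpoch f q n).
transitivity (K * ((a * q ^+ j) ^+ (n - j) * qpoch (e / a) q (n - j) * qpoch (f / a) q (n - j))); last first.
  by rewrite /K /h; ring.
rewrite -Hs mulr_sumr; apply: eq_bigr => i _.
have le_in := leq_ord i; move: (nat_of_ord i) le_in => {}i le_in.
have [p [nE e1 e2 e3 e4]] := nat_split3 le_jn le_in.
have [l1 l2 l3 l4] : [/\ j + i <= n, j <= n, i <= n & p <= n]%N.
  by rewrite nE leq_addr leq_addl -addnA leq_addr addnCA leq_addr.
have q1 : qpoch q q (j + i) != 0 by apply: qpoch_neq0W qn.
have q2 : qpoch q q j != 0 by apply: qpoch_neq0W qn.
have q3 : qpoch q q i != 0 by apply: qpoch_neq0W qn.
have q4 : qpoch q q p != 0 by apply: qpoch_neq0W qn.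
have d1 : qpoch d q (j + i) != 0 by apply: qpoch_neq0W dn.
have ed : qpoch d q (j + i) = qpoch d q j * qpoch (d * q ^+ j) q i by exact: qpochD.
have ea : qpoch a q (j + i) = qpoch a q j * qpoch (a * q ^+ j) q i by exact: qpochD.
have ee : qpoch e q n = qpoch e q (j + i) * qpoch (e * q ^+ j * q ^+ i) q p.
  by rewrite nE qpochD exprD mulrA.
have ef : qpoch f q n = qpoch f q (j + i) * qpoch (f * q ^+ j * q ^+ i) q p.
  by rewrite nE qpochD exprD mulrA.
move: en fn qnj d1; rewrite ee ef ed !mulf_eq0 !negb_or.
move=> /andP[en en1] /andP[fn fn1] qnj /andP[d1 d2].
rewrite /T /K /h /qbin e1 e2 e3 ee ef ed ea e4.
have -> : q ^+ (n * (j + i)) = q ^+ (n * j) * (q ^+ (i * j) * q ^+ ((i + p) * i)).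
  by rewrite -!exprD; congr (_ ^+ _); exact: muln_split3.
have -> : q ^+ 'C(j + i, 2) = q ^+ 'C(j, 2) * q ^+ 'C(i, 2) * q ^+ (i * j).
  by rewrite binD2 !exprD (mulnC j).
rewrite (exprD (-1)) (exprD q j i).
rewrite e4 in qnj; clear Hs Hin defabc gE T K h.
by field; rewrite q1 q2 q3 q4 d1 d2 en en1 fn fn1 qnj !expf_neq0.
Qed.

(** * The expansion that produces the sum over i *)

Lemma qpochDC x q k p :
  qpoch x q k * qpoch (x * q ^+ k) q p = qpoch x q p * qpoch (x * q ^+ p) q k.
Proof. by rewrite -!qpochD addnC. Qed.

Lemma qpoch_revM q x y k : q != 0 -> x * y * q ^+ k = q ->
  qpoch x q k = (-1) ^+ k * x ^+ k * q ^+ 'C(k, 2) * qpoch y q k.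
Proof. by move=> q0 /(qpoch_rev q0) ->; rewrite -[- x]mulN1r exprMn. Qed.

Lemma expr_expr_self q i : (q ^+ i) ^+ i = q ^+ 'C(i, 2) * q ^+ 'C(i, 2) * q ^+ i.
Proof. by rewrite -exprM sqr_bin2 !exprD. Qed.

Lemma prod_subX q x z k : x != 0 ->
  \prod_(t < k) (x - z * q ^+ t) = x ^+ k * qpoch (z / x) q k.
Proof.
move=> x0; rewrite -[X in x ^+ X]card_ord -prodr_const -big_split /=.
by apply: eq_bigr => t _; field.
Qed.

Lemma exprMNN x k : (-1) ^+ k * (- x) ^+ k = x ^+ k.
Proof. by rewrite -exprMn mulN1r opprK. Qed.

(** The part of [Tterm] free of j, m and n, with the integer powers of q written as quotients. *)
Definition lcoef q a c (l i : nat) : F :=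
  (-1) ^+ i * (c / a) ^+ i * ((1 - q ^+ (1 + 2 * i) / c ^+ 2) / (1 - q / c ^+ 2))
  * (qpoch (q ^+ l)^-1 q i * qpoch (q ^+ (1 + l) * a / c ^+ 2) q i * qpoch (q / c ^+ 2) q i
     / (qpoch q q i * qpoch (q / q ^+ l / a) q i * qpoch (q ^+ (2 + l) / c ^+ 2) q i)).

(* q_six_phi_five with base parameter q/c^2, y = q^(1-l-k)/a and d = -c/q. *)
Lemma l_reduction q a c (l k : nat) :
    q != 0 -> a != 0 -> c != 0 -> qpoch q q l != 0 ->
    qpoch (c ^+ 2 / q ^+ l.+1) q l != 0 -> qpoch (- (q * a / c)) q l != 0 ->
    qpoch (- (q * a / c)) q k != 0 ->
    1 - q / c ^+ 2 != 0 -> qpoch (q / q ^+ l / a) q l != 0 ->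
    qpoch (q ^+ (2 + l) / c ^+ 2) q l != 0 ->
  qpoch a q k * qpoch (q ^+ (1 + l) * a / c ^+ 2) q k * qpoch (- (q ^+ (1 + l) * a / c)) q k
    / qpoch (- (q * a / c)) q k
  = qpoch a q l * qpoch (- (c / q ^+ l)) q l
    / (qpoch (c ^+ 2 / q ^+ l.+1) q l * qpoch (- (q * a / c)) q l)
  * \sum_(i < l.+1) lcoef q a c l i
      * qpoch (q ^+ l / q ^+ i * a) q k * qpoch (q ^+ (1 + l + i) * a / c ^+ 2) q k.
Proof.
move=> q0 a0 c0 ql hcl hal hak hc hia hic.
have hc2 : qpoch (q ^+ 2 / c ^+ 2) q l != 0.
  move: hcl; rewrite (@qpoch_revM _ _ (q ^+ 2 / c ^+ 2)) //.
    by rewrite mulf_eq0 negb_or => /andP[].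
  by rewrite !exprS expr0; field; rewrite q0 c0 expf_neq0.
(* The products (q^2/c^2)_l and (q^(2+l)/c^2)_l join to (q^2/c^2)_(2l), whose factors are 1 -
   (q/c^2) q^s for 1 <= s <= 2l. *)
have hA s : (0 < s < l.*2)%N -> 1 - q / c ^+ 2 * q ^+ s != 0.
  have H : qpoch (q ^+ 2 / c ^+ 2) q (l + l) != 0.
    rewrite qpochD mulf_neq0 //; move: hic; rewrite exprD.
    by rewrite (_ : _ / _ * q ^+ l = q ^+ 2 * q ^+ l / c ^+ 2) //; ring.
  move=> Hs; have /qpoch_neq0P /(_ s.-1) := H.
  rewrite (_ : s.-1 < l + l)%N; last by clear - Hs; lia.
  move=> /(_ isT); congr (_ != _); congr (_ - _).
  by rewrite -[in RHS](prednK (_ : 0 < s)%N) ?exprS; [ring|by case/andP: Hs].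
(* This y makes A q / y = q^(1+l+k) a / c^2, and makes the closed form (-yc/q)_l a reversal of
   (-q^(1+k) a/c)_l, with [M] as the constant. *)
pose A := q / c ^+ 2; pose y := q / (a * q ^+ l * q ^+ k).
have H := @q_six_phi_five q A y (- (c / q)) l ql hA.
pose M := (c / (a * q ^+ l * q ^+ k)) ^+ l * q ^+ 'C(l, 2).
have M0 : M != 0.
  by rewrite /M !(mulf_neq0, expf_neq0, invr_neq0).
have Dc0 : q ^+ (1 + l) * a / c ^+ 2 != 0 by rewrite !(mulf_neq0, expf_neq0, invr_neq0).
set Dc := q ^+ (1 + l) * a / c ^+ 2.
have HL : qpoch (y * - (c / q)) q l = M * qpoch (- (q * a / c) * q ^+ k) q l.
  rewrite (@qpoch_revM _ _ (- (q * a / c) * q ^+ k)) //; last first.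
    by rewrite /y; field; rewrite a0 q0 c0 !expf_neq0.
  rewrite -exprMn /M; congr (_ ^+ _ * _ * _).
  by rewrite /y; field; rewrite a0 q0 !expf_neq0.
(* The quotient (-q^(1+l) a/c)_k / (-qa/c)_k equals (-q^(1+k) a/c)_l / (-qa/c)_l, which has the
   fixed length l and is evaluated by the 6phi5 sum. *)
transitivity ((qpoch (- (q * a / c)) q l)^-1 * (qpoch a q k * qpoch Dc q k / M * qpoch (y * - (c / q)) q l)).
  rewrite HL.
  have := qpochDC (- (q * a / c)) q k l.
  rewrite (_ : - (q * a / c) * q ^+ l = - (q ^+ (1 + l) * a / c)); last by rewrite exprS; ring.
  move=> /esym/(canRL (mulKf hal)) ->.
  by field; rewrite hal hak M0.
rewrite -H !mulr_sumr; apply: eq_bigr => i _.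
have le_il := leq_ord i; move: (nat_of_ord i) le_il => {}i le_il.
have qi : qpoch q q i != 0 by apply: qpoch_neq0W ql.
have hici : qpoch (q ^+ (2 + l) / c ^+ 2) q i != 0 by apply: qpoch_neq0W hic.
have hiai : qpoch (q / q ^+ l / a) q i != 0 by apply: qpoch_neq0W hia.
clear H HL.
have [p lE] : exists p, l = (i + p)%N by exists (l - i)%N; rewrite subnKC.
have lp : (l - i = p)%N by rewrite lE addKn.
rewrite /lcoef lp.
have hal' : qpoch a q l != 0.
  move: hia; rewrite (@qpoch_revM _ _ a) //; last by field; rewrite a0 expf_neq0.
  by rewrite mulf_eq0 negb_or => /andP[].
have hap : qpoch a q p != 0 by apply: qpoch_neq0W hal'; rewrite lE leq_addl.
have haq : qpoch (a * q ^+ p) q i != 0.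
  by move: hal'; rewrite lE addnC qpochD mulf_eq0 negb_or => /andP[].
have y0 : y != 0 by rewrite /y !(mulf_neq0, expf_neq0, invr_neq0).
have E1 : \prod_(t < i) ((q ^+ t - - (c / q)) * (y - A * q ^+ t.+1))
    = (c / q) ^+ i * qpoch (- (q / c)) q i * y ^+ i * qpoch (Dc * q ^+ k) q i.
  rewrite big_split /=.
  have -> : \prod_(t < i) (q ^+ t - - (c / q)) = (c / q) ^+ i * qpoch (- (q / c)) q i.
    rewrite (eq_bigr (fun t : 'I_i => c / q - (-1) * q ^+ t)) => [|t _]; last by ring.
    rewrite prod_subX ?mulf_neq0 ?invr_neq0 //; congr (_ * qpoch _ _ _).
    by field; rewrite c0 q0.
  have -> : \prod_(t < i) (y - A * q ^+ t.+1) = y ^+ i * qpoch (Dc * q ^+ k) q i.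
    rewrite (eq_bigr (fun t : 'I_i => y - A * q * q ^+ t)) => [|t _]; last first.
      by rewrite exprS; ring.
    rewrite prod_subX //; congr (_ * qpoch _ _ _).
    by rewrite /A /y /Dc (exprS q l); field; rewrite a0 c0 q0 !expf_neq0.
  by rewrite mulrA.
have E2 : qpoch (- (q / c)) q l
    = qpoch (- (q / c)) q i * qpoch (A * - (c / q) * q ^+ i.+1) q p.
  rewrite lE qpochD; congr (_ * qpoch _ _ _).
  by rewrite /A (exprS q i); field; rewrite c0 q0.
have E3 : qpoch (y * q ^+ i) q p
    = (-1) ^+ p * (y * q ^+ i) ^+ p * q ^+ 'C(p, 2) * qpoch (a * q ^+ k) q p.
  apply: qpoch_revM => //; rewrite /y lE exprD.
  by field; rewrite a0 !expf_neq0.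
(* Together with (A)_i the two products on the left make up (A)_(l+i+1) except for 1 - A q^(2i).
   This is where the very-well-poised factor comes from. *)
have E4 : (qpoch (A * q ^+ i) q i * qpoch (A * q ^+ i.*2.+1) q p)^-1
    = qpoch A q i * (1 - A * q ^+ i.*2) / ((1 - A) * qpoch (q ^+ 2 / c ^+ 2) q l
       * qpoch (q ^+ (2 + l) / c ^+ 2) q i).
  have : qpoch A q (l + i).+1 = (1 - A) * qpoch (q ^+ 2 / c ^+ 2) q l
       * qpoch (q ^+ (2 + l) / c ^+ 2) q i.
    rewrite qpochSl qpochD mulrA; congr (_ * qpoch _ _ _ * qpoch _ _ _); rewrite /A ?exprD; ring.
  rewrite lE (_ : (i + p + i).+1 = i + i + p.+1)%N; last by clear; lia.
  rewrite qpochD addnn qpochSX -addnn qpochD addnn -lE => E.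
  have nz : (1 - A) * qpoch (q ^+ 2 / c ^+ 2) q l * qpoch (q ^+ (2 + l) / c ^+ 2) q i != 0.
    by rewrite !mulf_neq0.
  rewrite -E; move: nz; rewrite -E !mulf_eq0 !negb_or => /andP[/andP[n1 n2] /andP[n3 n4]].
  by field; rewrite n1 n2 n3 n4.
have E5 : qpoch (q / q ^+ l / a) q i
   = (-1) ^+ i * (q / q ^+ l / a) ^+ i * q ^+ 'C(i, 2) * qpoch (a * q ^+ p) q i.
  by apply: qpoch_revM => //; rewrite lE exprD; field; rewrite a0 !expf_neq0.
have E5' : qpoch a q l = qpoch a q p * qpoch (a * q ^+ p) q i.
  by rewrite lE addnC qpochD.
have E6 : qpoch (- (c / q ^+ l)) q l = (c / q ^+ l) ^+ l * q ^+ 'C(l, 2) * qpoch (- (q / c)) q l.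
  by rewrite -[X in _ = X * _ * _]exprMNN; apply: qpoch_revM => //; field; rewrite c0 expf_neq0.
have E7 : qpoch (c ^+ 2 / q ^+ l.+1) q l
    = (-1) ^+ l * (c ^+ 2 / q ^+ l.+1) ^+ l * q ^+ 'C(l, 2) * qpoch (q ^+ 2 / c ^+ 2) q l.
  by apply: qpoch_revM => //; rewrite (exprS q l); field; rewrite q0 c0 expf_neq0.
have E8 : qpoch (q ^+ l / q ^+ i * a) q k = qpoch a q k * qpoch (a * q ^+ k) q p / qpoch a q p.
  apply: (canRL (mulfK hap)); rewrite qpochDC mulrC; congr (_ * qpoch _ _ _).
  by rewrite lE exprD; field; rewrite expf_neq0.
have E9 := qbin_qpoch q0 ql le_il.
have E10 := qpochDC Dc q k i.
have -> : q ^+ (1 + l + i) * a / c ^+ 2 = Dc * q ^+ i by rewrite /Dc exprD; ring.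
rewrite -/Dc -/A (_ : q ^+ (1 + 2 * i) / c ^+ 2 = A * q ^+ i.*2); last first.
  by rewrite /A mul2n (exprS q i.*2); ring.
have {}E9 : qpoch (q ^+ l)^-1 q i
    = qbin q l i * (-1) ^+ i * q ^+ 'C(i, 2) / q ^+ (l * i) * qpoch q q i.
  by rewrite -E9 divfK.
pose K := (qpoch (- (q * a / c)) q l)^-1 * (qpoch a q k / M * (qbin q l i * q ^+ 'C(i, 2)
  * ((c / q) ^+ i * qpoch (- (q / c)) q i * y ^+ i)
  * qpoch (A * - (c / q) * q ^+ i.+1) q p * qpoch (y * q ^+ i) q p
  * (qpoch (A * q ^+ i) q i * qpoch (A * q ^+ i.*2.+1) q p)^-1)).
transitivity (K * (qpoch Dc q k * qpoch (Dc * q ^+ k) q i)).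
  by rewrite E1 /K; ring.
rewrite E10 /K E3 E4 E5' E6 E2 E7 E8 E9 E5.
have hq1 : 1 - A != 0 by [].
move: M0 hal hc2 hici hap haq; rewrite /M /y.
clear - q0 a0 c0 hq1 qi lE.
set u1 := qpoch (- (q * a / c)) q l; set u2 := qpoch (q ^+ 2 / c ^+ 2) q l.
set u3 := qpoch (q ^+ (2 + l) / c ^+ 2) q i; set u4 := qpoch a q p.
set u5 := qpoch (a * q ^+ p) q i; set u6 := qbin q l i.
set u7 := qpoch _ q p; set u8 := qpoch (a * _) q p; set u9 := qpoch a q k.
set v1 := qpoch Dc q i; set v2 := qpoch _ q k; set v3 := qpoch A q i.
set v4 := qpoch _ q i; set w := 1 - A * _.
rewrite lE => _ u10 u20 u30 u40 u50.
rewrite binD2 (exprS q (i + p)) !(exprD, exprMn, exprVn, exprM) !expr_expr_self.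
rewrite (exprAC q p i).
have signV n : (-1) ^+ n = ((-1) ^+ n)^-1 :> F by rewrite invr_sign.
rewrite {1}(signV p).
by field; rewrite ?(u10, u20, u30, u40, u50, hq1, qi, q0, c0, a0) ?expf_neq0 ?oppr_eq0 ?oner_eq0 ?q0 ?a0 ?c0.
Qed.

(** * The expansion that produces the sum over j *)

(** Multiplied by (q)_n both sides are (q)_(2n), separated by the parity of the exponents on the
    left and cut in the middle on the right. *)
Lemma qpoch_odd_even q n : qpoch q q n != 0 ->
  qpoch (- q) q n * qpoch q (q ^+ 2) n = qpoch (q ^+ n.+1) q n.
Proof.
move=> qn.
have sq k : qpoch (q ^+ 2) (q ^+ 2) k = qpoch q q k * qpoch (- q) q k.
  elim: k => [|k IH]; first by rewrite !qpoch0 mulr1.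
  by rewrite !qpochS IH -exprM mulnC exprM; ring.
have odd_even k : qpoch q q k.*2 = qpoch q (q ^+ 2) k * qpoch (q ^+ 2) (q ^+ 2) k.
  elim: k => [|k IH]; first by rewrite !qpoch0 mulr1.
  by rewrite doubleS !qpochS IH -!exprM mul2n !exprS expr0; ring.
apply: (mulfI qn); rewrite [q ^+ n.+1]exprS -qpochD addnn odd_even sq; ring.
Qed.

(* conn_coef absorbs the products that mcoef keeps in its denominators: it stays
   meaningful when (-q)_(n-j) = 0, see conn_coef_mcoef. *)
Definition conn_coef q (m n j : nat) : F :=
  qpoch q q n / qpoch q q (n - j) * qbin q m j * (-1) ^+ j
  * (q ^+ 'C(j, 2) * q ^+ 'C(j, 2)) / (q ^+ n ^+ j * q ^+ n ^+ j)
  * \prod_(t < j) (q ^+ t - - q ^+ n) * (q * (q ^+ n / q ^+ m)) ^+ j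
  * ((-1) ^+ (m - j) * (q ^+ j.*2 / q ^+ n.*2) ^+ (m - j) * q ^+ 'C(m - j, 2))
  * qpoch (q * (q ^+ n / q ^+ m)) q (m - j)
  / (qpoch (q ^+ j / q ^+ n.*2.+1) q j * qpoch (q ^+ j.*2 / q ^+ n.*2) q (m - j)).

(** The part of the summand of [andrews_q_watson] free of u and v. *)
Definition watson_coef q (n k : nat) : F :=
  qbin q n k * q ^+ 'C(k.+1, 2)
      * qpoch (- q ^+ (n - k).+1) q k * qpoch (q ^+ n.+1) q (n - k).

(* q_six_phi_five with base parameter q^(-2n-1), y = q^(k-2n) and d = -q^n; the
   terms with j > k vanish. *)
Lemma m_connection q (m n k : nat) :
    q != 0 -> qpoch q q n != 0 -> (m <= n)%N -> (k <= n)%N ->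
    (forall s, (0 < s < m.*2)%N -> 1 - (q ^+ n.*2.+1)^-1 * q ^+ s != 0) ->
  qbin q n k * (q * (q ^+ n / q ^+ m)) ^+ k * qpoch (- (q ^+ m / q ^+ n)) q k
    * qpoch (q * (q ^+ n / q ^+ m)) q (n - k)
  = \sum_(j < m.+1) (if (j <= k)%N then conn_coef q m n j * watson_coef q (n - j) (k - j) else 0).
Proof.
move=> q0 qn le_mn le_kn hA.
have qm := qpoch_neq0W le_mn qn.
have H := @q_six_phi_five q (q ^+ n.*2.+1)^-1 (q ^+ k / q ^+ n.*2) (- q ^+ n) m qm hA.
(* A zero factor 1 + q^(t-n) would force 1 - q^(2t-2n) = 0, which is [hA] at the odd exponent s = 2t
   + 1. *)
have hm : qpoch (- (q ^+ n)^-1) q m != 0.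
  apply/qpoch_neq0P => t lt_tm.
  have Ht : (0 < t.*2.+1 < m.*2)%N by clear - lt_tm; lia.
  apply: contraNneq (hA _ Ht) => h.
  have -> : (q ^+ n.*2.+1)^-1 * q ^+ t.*2.+1 = (- (q ^+ n)^-1 * q ^+ t) ^+ 2.
    by rewrite !exprS -!addnn !exprD expr0; field; rewrite q0 expf_neq0.
  by rewrite -[X in X - _](expr1n _ 2) subr_sqr h mul0r.
(* Exchanging the lengths k and m brings in (-q^(k-n))_m, the closed form of the 6phi5 sum [H]. *)
have -> : qpoch (- (q ^+ m / q ^+ n)) q k
    = qpoch (- (q ^+ n)^-1) q k / qpoch (- (q ^+ n)^-1) q m
      * qpoch (q ^+ k / q ^+ n.*2 * - q ^+ n) q m.
  have := qpochDC (- (q ^+ n)^-1) q m k.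
  rewrite (_ : - (q ^+ n)^-1 * q ^+ m = - (q ^+ m / q ^+ n)); last by ring.
  rewrite (_ : - (q ^+ n)^-1 * q ^+ k = q ^+ k / q ^+ n.*2 * - q ^+ n); last first.
    by rewrite -addnn exprD; field; rewrite expf_neq0.
  by move=> /(canRL (mulKf hm)) ->; field.
rewrite -H mulrA mulr_sumr mulr_suml; apply: eq_bigr => j _; clear H.
have le_jm := leq_ord j; move: (nat_of_ord j) le_jm => {}j le_jm.
case: leqP => [le_jk|lt_kj]; last first.
  (* For j > k the factor t = k of the product is q^(k-2n) - q^(-2n-1) q^(k+1) = 0. *)
  rewrite (bigD1 (Ordinal lt_kj)) //= (_ : _ - _ * _ = 0) ?(mul0r, mulr0) //.
  by rewrite !exprS; field; rewrite q0 expf_neq0.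
have hAj : qpoch ((q ^+ n.*2.+1)^-1 * q ^+ j) q j != 0.
  apply/qpoch_neq0P => t lt_tj; rewrite -mulrA -exprD; apply: hA.
  by clear - lt_tj le_jm; lia.
have hAr : qpoch ((q ^+ n.*2.+1)^-1 * q ^+ j.*2.+1) q (m - j) != 0.
  apply/qpoch_neq0P => t lt_tj; rewrite -mulrA -exprD; apply: hA.
  by clear - lt_tj le_jm; lia.
have F5 : (q ^+ n.*2.+1)^-1 * q ^+ j = q ^+ j / q ^+ n.*2.+1 by rewrite mulrC.
have F5' : (q ^+ n.*2.+1)^-1 * q ^+ j.*2.+1 = q ^+ j.*2 / q ^+ n.*2.
  by rewrite !exprS; field; rewrite q0 expf_neq0.
rewrite F5 F5' in hAj hAr *.
have [p [nE kE]] : exists p, n = (k + p)%N /\ k = (j + (k - j))%N.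
  by exists (n - k)%N; rewrite !subnKC.
have [i kjE] : exists i, i = (k - j)%N by exists (k - j)%N.
have [r rE] : exists r, r = (m - j)%N by exists (m - j)%N.
have mE : m = (j + r)%N by rewrite rE subnKC.
rewrite -kjE in kE.
have nkp : (n - k = p)%N by rewrite nE addKn.
have njE : (n - j = i + p)%N by rewrite nE kE -addnA addKn.
rewrite -rE in hAr *; rewrite /conn_coef /watson_coef -rE -kjE nkp njE (addKn i p).
have F1 : \prod_(t < j) (q ^+ k / q ^+ n.*2 - (q ^+ n.*2.+1)^-1 * q ^+ t.+1)
   = (q ^+ k / q ^+ n.*2) ^+ j * ((-1) ^+ j * (q ^+ k)^-1 ^+ j * q ^+ 'C(j, 2)
      * qpoch (q ^+ i.+1) q j).
  rewrite (eq_bigr (fun t : 'I_j => q ^+ k / q ^+ n.*2 - (q ^+ n.*2)^-1 * q ^+ t)).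
    rewrite prod_subX ?mulf_neq0 ?invr_neq0 ?expf_neq0 //; congr (_ * _).
    rewrite (_ : _ / _ = (q ^+ k)^-1); last by field; rewrite !expf_neq0.
    apply: qpoch_revM => //; rewrite kE exprD exprS.
    by field; rewrite !expf_neq0.
  by move=> t _; rewrite !exprS; field; rewrite q0 !expf_neq0.
set x0 := - (q ^+ n)^-1 in hm *.
have F2 : qpoch x0 q k = qpoch x0 q j * ((q ^+ j / q ^+ n) ^+ i * q ^+ 'C(i, 2)
    * qpoch (- q ^+ p.+1) q i).
  rewrite {1}kE qpochD; congr (_ * _).
  rewrite -[X in _ = X * _ * _]exprMNN (_ : - (_ / _) = x0 * q ^+ j); last by rewrite /x0; ring.
  apply: qpoch_revM => //; rewrite /x0 nE kE !exprD exprS.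
  by field; rewrite !expf_neq0.
have F3 : qpoch x0 q m = qpoch x0 q j * qpoch ((q ^+ n.*2.+1)^-1 * - q ^+ n * q ^+ j.+1) q r.
  rewrite mE qpochD; congr (_ * qpoch _ _ _).
  by rewrite /x0 -addnn !exprS exprD; field; rewrite q0 expf_neq0.
have F4 : qpoch (q ^+ k / q ^+ n.*2 * q ^+ j) q r = (-1) ^+ r
    * (q ^+ k / q ^+ n.*2 * q ^+ j) ^+ r * q ^+ 'C(r, 2)
    * qpoch (q * (q ^+ n / q ^+ m) * q ^+ p) q r.
  by apply: qpoch_revM => //; rewrite -addnn mE nE !exprD; field; rewrite !expf_neq0.
(* Exchanging the lengths p = n - k and r = m - j splits off a product free of k and leaves
   (q^(n-j+1))_(n-k), the last factor of [watson_coef]. *)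
have F6 : qpoch (q * (q ^+ n / q ^+ m)) q p * qpoch (q * (q ^+ n / q ^+ m) * q ^+ p) q r
    = qpoch (q * (q ^+ n / q ^+ m)) q r * qpoch (q ^+ (i + p).+1) q p.
  rewrite qpochDC; congr (_ * qpoch _ _ _).
  by rewrite mE nE kE !(exprS, exprD); field; rewrite !expf_neq0.
have F7 : qpoch q q k = qpoch q q i * qpoch (q ^+ i.+1) q j.
  by rewrite kE addnC qpochD exprS.
have qk := qpoch_neq0W le_kn qn.
have qip : qpoch q q (i + p) != 0 by apply: qpoch_neq0W qn; rewrite nE kE -addnA leq_addl.
have qp : qpoch q q p != 0 by apply: qpoch_neq0W qip; rewrite leq_addl.
pose K := qbin q n k * (q * (q ^+ n / q ^+ m)) ^+ k * (qpoch x0 q k / qpoch x0 q m)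
  * (qbin q m j * q ^+ 'C(j, 2)
    * (\prod_(t < j) (q ^+ t - - q ^+ n)
       * \prod_(t < j) (q ^+ k / q ^+ n.*2 - (q ^+ n.*2.+1)^-1 * q ^+ t.+1))
    * qpoch ((q ^+ n.*2.+1)^-1 * - q ^+ n * q ^+ j.+1) q r
    * ((-1) ^+ r * (q ^+ k / q ^+ n.*2 * q ^+ j) ^+ r * q ^+ 'C(r, 2))
    / (qpoch (q ^+ j / q ^+ n.*2.+1) q j * qpoch (q ^+ j.*2 / q ^+ n.*2) q r)).
transitivity (K * (qpoch (q * (q ^+ n / q ^+ m)) q p * qpoch (q * (q ^+ n / q ^+ m) * q ^+ p) q r)).
  by rewrite F4 big_split /= /K; ring.
rewrite F6 /K F1 F2 /qbin nkp addKn.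
move: hm hAj hAr qk; rewrite F3 F7 !mulf_eq0 !negb_or.
clear - q0 qip qp nE kE mE; set u1 := qpoch q q n; set u2 := qpoch x0 q j.
set u3 := qpoch (_ * _ * _) q r; set u4 := qpoch (q ^+ j / _) q j.
set u5 := qpoch _ q r; set u6 := qpoch _ q r; set u7 := qpoch _ q p.
set u8 := qpoch _ q i; set u9 := \prod_(t < j) _; set v1 := _ / (_ * qpoch q q (m - j)).
move=> /andP[u20 u30] u40 u50 /andP[qi v20].
have np : n = (j + i + p)%N by rewrite nE kE.
rewrite binS bin1.
have -> : q ^+ k = q ^+ j * q ^+ i by rewrite kE exprD.
have -> : q ^+ m = q ^+ j * q ^+ r by rewrite mE exprD.
have -> : q ^+ n.*2 = q ^+ n * q ^+ n by rewrite -addnn exprD.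
have -> : q ^+ j.*2 = q ^+ j * q ^+ j by rewrite -addnn exprD.
have -> : q ^+ n = q ^+ j * q ^+ i * q ^+ p by rewrite np !exprD.
rewrite kE !(exprMn, exprVn, exprD) !expr_expr_self.
rewrite (exprAC q r j) (exprAC q r i) (exprAC q i j).
by field; rewrite ?(u20, u30, u40, u50, qi, v20, qip, qp) ?expf_neq0 ?oppr_eq0 ?oner_eq0 ?q0.
Qed.

(** The part of [Tterm] that involves q, m, n and j alone, except for 1 / (q; q^2)_(n-j). *)
Definition mcoef q (m n j : nat) : F :=
  q ^+ m ^+ j / q ^+ n ^+ j * q ^+ 'C(j.+1, 2)
  * (qpoch (q ^+ m)^-1 q j * qpoch (q ^+ n)^-1 q j * qpoch (- (q ^+ n)^-1) q j)
  / (qpoch q q j * qpoch (q ^+ m / q ^+ n.*2) q j * qpoch (q ^+ j / q ^+ n.*2.+1) q j).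

(** The factor (-q)_(n-j) is supplied by the q-Watson sum. Multiplication by (q; q^2)_(n-j) turns it
    into (q^(n-j+1))_(n-j), which combines with the reversed products in the denominators. *)
Lemma conn_coef_mcoef q (m n j : nat) :
    q != 0 -> qpoch q q n != 0 -> (m <= n)%N -> (j <= m)%N ->
    qpoch (q ^+ m / q ^+ n.*2) q j != 0 ->
    qpoch (q ^+ j / q ^+ n.*2.+1) q j != 0 ->
    qpoch (q ^+ j.*2 / q ^+ n.*2) q (m - j) != 0 ->
    qpoch q (q ^+ 2) (n - j) != 0 ->
  conn_coef q m n j * qpoch (- q) q (n - j)
  = qpoch (q * (q ^+ n / q ^+ m)) q n * mcoef q m n j / qpoch q (q ^+ 2) (n - j).
Proof.
move=> q0 qn le_mn le_jm h1 h2 h3 h4.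
have le_jn := leq_trans le_jm le_mn.
have qN : qpoch q q (n - j) != 0 by apply: qpoch_neq0W qn; exact: leq_subr.
apply: (canRL (mulfK h4)); rewrite -mulrA qpoch_odd_even //.
have qm := qpoch_neq0W le_mn qn; have qj := qpoch_neq0W le_jn qn.
have E1 : qpoch (q ^+ m)^-1 q j = qbin q m j * (-1) ^+ j * q ^+ 'C(j, 2) / q ^+ (m * j) * qpoch q q j.
  by rewrite -qbin_qpoch // divfK.
have E2 : qpoch (q ^+ n)^-1 q j
    = qpoch q q n / qpoch q q (n - j) * (-1) ^+ j * q ^+ 'C(j, 2) / q ^+ (n * j).
  rewrite -[LHS](divfK qj) qbin_qpoch // /qbin; field.
  by rewrite !expf_neq0 // qj qN.
rewrite /conn_coef /mcoef {}E1 {}E2.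
have [N NE] : exists N, N = (n - j)%N by exists (n - j)%N.
have [r rE] : exists r, r = (m - j)%N by exists (m - j)%N.
rewrite -NE -rE in h3 h4 qN *.
have nE : n = (j + N)%N by rewrite NE subnKC.
have mE : m = (j + r)%N by rewrite rE subnKC.
set X := q * (q ^+ n / q ^+ m).
have G3 : qpoch (q ^+ j.*2 / q ^+ n.*2) q r
    = (-1) ^+ r * (q ^+ j.*2 / q ^+ n.*2) ^+ r * q ^+ 'C(r, 2) * qpoch (X * q ^+ N) q r.
  apply: qpoch_revM => //; rewrite /X mE nE -!addnn !exprD.
  by field; rewrite !expf_neq0.
have G4 : qpoch (q ^+ m / q ^+ n.*2) q j
    = (-1) ^+ j * (q ^+ m / q ^+ n.*2) ^+ j * q ^+ 'C(j, 2) * qpoch (X * q ^+ N) q j.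
  apply: qpoch_revM => //; rewrite /X mE nE -!addnn !exprD.
  by field; rewrite !expf_neq0.
have G2 : qpoch X q r * qpoch (q ^+ N.+1) q N = qpoch X q N * qpoch (X * q ^+ N) q r.
  rewrite -qpochDC; congr (_ * qpoch _ _ _).
  by rewrite /X mE nE !(exprS, exprD); field; rewrite !expf_neq0.
have G4' : qpoch X q n = qpoch X q N * qpoch (X * q ^+ N) q j by rewrite nE addnC qpochD.
have G5 : \prod_(t < j) (q ^+ t - - q ^+ n) = q ^+ n ^+ j * qpoch (- (q ^+ n)^-1) q j.
  rewrite (eq_bigr (fun t : 'I_j => q ^+ n - (-1) * q ^+ t)) => [|t _]; last by ring.
  by rewrite prod_subX ?expf_neq0 // mulN1r.
set a1 := qpoch q q n / qpoch q q N; set b := qbin q m j.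
transitivity (a1 * b * (-1) ^+ j
  * (q ^+ 'C(j, 2) * q ^+ 'C(j, 2)) / (q ^+ n ^+ j * q ^+ n ^+ j)
  * \prod_(t < j) (q ^+ t - - q ^+ n) * X ^+ j
  * ((-1) ^+ r * (q ^+ j.*2 / q ^+ n.*2) ^+ r * q ^+ 'C(r, 2))
  / (qpoch (q ^+ j / q ^+ n.*2.+1) q j * qpoch (q ^+ j.*2 / q ^+ n.*2) q r)
  * (qpoch X q r * qpoch (q ^+ N.+1) q N)).
  by rewrite -/X; ring.
rewrite G2 G4' G5; move: h1 h3; rewrite G3 G4 !mulf_eq0 !negb_or.
move=> /andP[_ h1] /andP[_ h3].
move: h1 h2 h3; rewrite /X; set u1 := qpoch _ q j; set u2 := qpoch _ q j.
set u3 := qpoch _ q r; set u4 := qpoch _ q j; set u5 := qpoch _ q N => h1 h2 h3.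
clear - q0 qj h1 h2 h3 nE mE; clearbody b a1 u1 u2 u3 u4 u5.
rewrite binS bin1.
have -> : q ^+ n.*2 = q ^+ n * q ^+ n by rewrite -addnn exprD.
have -> : q ^+ j.*2 = q ^+ j * q ^+ j by rewrite -addnn exprD.
rewrite !(exprMn, exprVn, exprD, exprM).
by field; rewrite ?(h1, h2, h3, qj) ?expf_neq0 ?oppr_eq0 ?oner_eq0 ?q0.
Qed.

(** The factors with m are expanded by [m_connection]. After the shift k = j + i the inner sum is
    [andrews_q_watson] for n - j, u q^j and v q^j. *)
Lemma m_reduction q u v (m n : nat) :
    q != 0 -> qpoch q q n != 0 -> (m <= n)%N ->
    qpoch (q ^+ m / q ^+ n.*2) q m != 0 ->
    (forall j, (j <= m)%N -> qpoch (q ^+ j / q ^+ n.*2.+1) q j != 0) ->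
    qpoch q (q ^+ 2) n != 0 -> qpoch (q * u * v) (q ^+ 2) n != 0 ->
  \sum_(k < n.+1) qbin q n k * (q * (q ^+ n / q ^+ m)) ^+ k
     * qpoch (- (q ^+ m / q ^+ n)) q k * qpoch (q * (q ^+ n / q ^+ m)) q (n - k)
     * (qpoch u q k * qpoch v q k / qpoch (q * u * v) (q ^+ 2) k)
  = qpoch (q * (q ^+ n / q ^+ m)) q n
  * \sum_(j < m.+1) mcoef q m n j
     * (qpoch u q j * qpoch v q j / qpoch (q * u * v) (q ^+ 2) j)
     * (qpoch (q * (u * q ^+ j)) (q ^+ 2) (n - j) * qpoch (q * (v * q ^+ j)) (q ^+ 2) (n - j)
        / (qpoch q (q ^+ 2) (n - j) * qpoch (q * u * v * (q ^+ 2) ^+ j) (q ^+ 2) (n - j))).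
Proof.
move=> q0 qn le_mn hm hj hq hw.
(* The product (q^(j-2n-1))_j has the exponents j to 2j - 1 above -2n-1. For j = 1 + s/2, rounded
   down, this range contains s. *)
have hA s : (0 < s < m.*2)%N -> 1 - (q ^+ n.*2.+1)^-1 * q ^+ s != 0.
  move=> Hs; have le : (s./2.+1 <= m)%N by clear - Hs; lia.
  have /qpoch_neq0P /(_ (s - s./2.+1)%N) := hj _ le.
  rewrite [_ / _]mulrC -mulrA -exprD subnKC; last by clear - Hs; lia.
  by apply; clear - Hs; lia.
pose g k := qpoch u q k * qpoch v q k / qpoch (q * u * v) (q ^+ 2) k.
transitivity (\sum_(k < n.+1) \sum_(j < m.+1)
    (if (j <= k)%N then conn_coef q m n j * watson_coef q (n - j) (k - j) * g k else 0)).
  apply: eq_bigr => k _; rewrite m_connection ?leq_ord // mulr_suml.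
  by apply: eq_bigr => j _; case: leqP => _ //; rewrite mul0r.
rewrite exchange_big /= mulr_sumr; apply: eq_bigr => j _.
have le_jm := leq_ord j; move: (nat_of_ord j) le_jm => {}j le_jm.
have le_jn := leq_trans le_jm le_mn.
rewrite (sum_shift (fun k => conn_coef q m n j * watson_coef q (n - j) (k - j) * g k)) //.
have qN : qpoch q q (n - j) != 0 by apply: qpoch_neq0W qn; exact: leq_subr.
have hwj : qpoch (q * u * v) (q ^+ 2) j != 0 by apply: qpoch_neq0W hw.
have hwN : qpoch (q * u * v * (q ^+ 2) ^+ j) (q ^+ 2) (n - j) != 0.
  by move: hw; rewrite -{1}(subnKC le_jn) qpochD mulf_eq0 negb_or => /andP[].
have HW := andrews_q_watson (u * q ^+ j) (v * q ^+ j) qN.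
have Hn : conn_coef q m n j * qpoch (- q) q (n - j)
    = qpoch (q * (q ^+ n / q ^+ m)) q n * mcoef q m n j / qpoch q (q ^+ 2) (n - j).
  apply: conn_coef_mcoef => //; first exact: qpoch_neq0W hm.
  - exact: hj.
  - apply/qpoch_neq0P => t lt_t.
    rewrite (_ : _ * _ = (q ^+ n.*2.+1)^-1 * q ^+ (j.*2 + t).+1); last first.
      by rewrite !exprS exprD; field; rewrite q0 expf_neq0.
    by apply: hA; clear - lt_t le_jm; lia.
  - by apply: qpoch_neq0W hq; exact: leq_subr.
transitivity (g j / qpoch (q * u * v * (q ^+ 2) ^+ j) (q ^+ 2) (n - j)
   * (conn_coef q m n j * qpoch (- q) q (n - j))
   * (qpoch (q * (u * q ^+ j)) (q ^+ 2) (n - j) * qpoch (q * (v * q ^+ j)) (q ^+ 2) (n - j))); last first.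
  rewrite Hn /g; field.
  by rewrite hwN hwj /= andbT; apply: qpoch_neq0W hq; exact: leq_subr.
transitivity (g j / qpoch (q * u * v * (q ^+ 2) ^+ j) (q ^+ 2) (n - j) * conn_coef q m n j
   * (qpoch (- q) q (n - j) * qpoch (q * (u * q ^+ j)) (q ^+ 2) (n - j)
      * qpoch (q * (v * q ^+ j)) (q ^+ 2) (n - j))); last by ring.
rewrite -HW mulr_sumr; apply: eq_bigr => i _.
have le_iN := leq_ord i; move: (nat_of_ord i) le_iN => {}i le_iN.
rewrite addKn /g /watson_coef.
have -> : u * q ^+ j * (v * q ^+ j) * q ^+ i.*2.+1 = q * u * v * (q ^+ 2) ^+ j * (q ^+ 2) ^+ i.
  by rewrite -!exprM !mul2n exprS -!addnn !exprD; ring.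
have EN : qpoch (q * u * v * (q ^+ 2) ^+ j) (q ^+ 2) (n - j)
    = qpoch (q * u * v * (q ^+ 2) ^+ j) (q ^+ 2) i
      * qpoch (q * u * v * (q ^+ 2) ^+ j * (q ^+ 2) ^+ i) (q ^+ 2) (n - j - i).
  by rewrite -qpochD subnKC.
rewrite EN !qpochD; move: hwN hwj; rewrite EN mulf_eq0 negb_or => /andP[hw1 hw2] hwj.
by field; rewrite hw1 hw2 hwj.
Qed.

(** * Assembly of the double sum *)

Lemma qpoch_sqr q x k : qpoch (x ^+ 2) (q ^+ 2) k = qpoch x q k * qpoch (- x) q k.
Proof.
elim: k => [|k IH]; first by rewrite !qpoch0 mulr1.
by rewrite !qpochS IH -exprM mulnC exprM; ring.
Qed.

(** Sears' transformation with a and d kept: d over the other two upper parameters is q^(1+l) a/c^2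
    and -q^(m-n). The products in -q^(-n) c / a and -q^(-n) c are reversed into products in -qa/c
    and -q/c. *)
Lemma phi43_sears q a c (l m n : nat) :
    let E := q ^+ n / q ^+ m in
    let d := q ^+ (1 + l) * a / c in
    q != 0 -> a != 0 -> c != 0 -> qpoch q q n != 0 ->
    qpoch d q n != 0 -> qpoch (q * E * a) q n != 0 -> qpoch (- (c / q ^+ n)) q n != 0 ->
    qpoch (- (q * a / c)) q n != 0 ->
  \sum_(k < n.+1) qbin q n k * (-1) ^+ k * q ^+ 'C(k, 2) * q ^+ k / q ^+ (n * k)
      * (qpoch a q k * qpoch c q k * qpoch (- (q ^+ (1 + l) * E * a / c)) q k)
      / (qpoch d q k * qpoch (q * E * a) q k * qpoch (- (c / q ^+ n)) q k)
  = qpoch (- (q * a / c)) q n / (qpoch (q * E * a) q n * qpoch (- (q / c)) q n)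
    * \sum_(k < n.+1) qbin q n k * (q * E) ^+ k * qpoch (- (q ^+ m / q ^+ n)) q k
      * qpoch (q * E) q (n - k)
      * (qpoch a q k * qpoch (q ^+ (1 + l) * a / c ^+ 2) q k
         / (qpoch d q k * qpoch (- (q * a / c)) q k)).
Proof.
move=> E d q0 a0 c0 qn dn en fn aln.
have E0 : E != 0 by rewrite mulf_neq0 ?invr_neq0 ?expf_neq0.
have d0 : d != 0 by rewrite !(mulf_neq0, invr_neq0, expf_neq0).
rewrite sears_transformation //; first last.
- rewrite /d /E; field; rewrite c0 !expf_neq0 //.
  by rewrite mulf_neq0 // mulf_neq0.
- by rewrite oppr_eq0 !(mulf_neq0, invr_neq0, expf_neq0).
have Ef : qpoch (- (c / q ^+ n)) q n = (c / q ^+ n) ^+ n * q ^+ 'C(n, 2) * qpoch (- (q / c)) q n.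
  rewrite -[X in _ = X * _ * _]exprMNN; apply: qpoch_revM => //.
  by field; rewrite ?c0 ?expf_neq0.
rewrite !mulr_sumr; apply: eq_bigr => k _.
have le_kn := leq_ord k; move: (nat_of_ord k) le_kn => {}k le_kn.
rewrite (_ : c * - (q ^+ (1 + l) * E * a / c) / d = - (E * c)); last first.
  by rewrite /d; field; rewrite ?E0 ?a0 ?c0 ?expf_neq0.
rewrite (_ : d / - (q ^+ (1 + l) * E * a / c) = - (q ^+ m / q ^+ n)); last first.
  by rewrite /d /E; field; rewrite ?E0 ?a0 ?c0 ?oppr_eq0 ?mulf_neq0 ?expf_neq0.
rewrite (_ : d / c = q ^+ (1 + l) * a / c ^+ 2); last by rewrite /d; field; rewrite c0.
rewrite (_ : q * E * a / a = q * E); last by field; rewrite a0.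
set Dc := _ / c ^+ 2.
have [p pE] : exists p, p = (n - k)%N by exists (n - k)%N.
have nE : n = (k + p)%N by rewrite pE subnKC.
have Efa : qpoch (- (c / q ^+ n) / a) q p = (c / q ^+ n / a) ^+ p * q ^+ 'C(p, 2)
    * qpoch (- (q * a / c) * q ^+ k) q p.
  rewrite -[X in _ = X * _ * _]exprMNN [- _ / a]mulNr; apply: qpoch_revM => //.
  by rewrite nE exprD; field; rewrite ?E0 ?a0 ?c0 ?expf_neq0.
have Eal : qpoch (- (q * a / c)) q n
    = qpoch (- (q * a / c)) q k * qpoch (- (q * a / c) * q ^+ k) q p.
  by rewrite nE qpochD.
have dk := qpoch_neq0W le_kn dn; have alk := qpoch_neq0W le_kn aln.
rewrite -pE Efa Eal Ef; move: fn en; rewrite Ef mulf_eq0 negb_or => /andP[_ fn] en.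
set f0 := qpoch (- (q / c)) q n in fn *; set u1 := qpoch (- (q ^+ m / q ^+ n)) q k.
set u2 := qpoch (q * E) q p; set u3 := qpoch Dc q k; set u4 := qpoch _ q p.
clear Efa Eal Ef pE; clearbody Dc d E f0 u1 u2 u3 u4.
have -> : 'C(n, 2) = ('C(k, 2) + 'C(p, 2) + k * p)%N by rewrite nE binD2.
have -> : (c / q ^+ n) ^+ n = c ^+ k * c ^+ p / ((q ^+ n) ^+ k * (q ^+ n) ^+ p).
  by rewrite [X in _ ^+ X]nE exprMn exprVn !exprD.
have signV i : (-1) ^+ i = ((-1) ^+ i)^-1 :> F by rewrite invr_sign.
rewrite {1}(signV k) -[- (E * c)]mulN1r.
rewrite (exprM q n k) (_ : q ^+ n = q ^+ k * q ^+ p); last by rewrite nE exprD.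
rewrite !(exprMn, exprVn, exprD, exprM) !expr_expr_self (exprAC q p k).
by field; rewrite ?(alk, dk, fn, en) ?expf_neq0 ?oppr_eq0 ?oner_eq0.
Qed.

Lemma phi43_double_sum q a c (l m n : nat) :
    let E := q ^+ n / q ^+ m in
    let d := q ^+ (1 + l) * a / c in
    q != 0 -> a != 0 -> c != 0 -> (m <= n)%N -> qpoch q q n != 0 -> qpoch q q l != 0 ->
    qpoch d q n != 0 -> qpoch (q * E * a) q n != 0 -> qpoch (- (c / q ^+ n)) q n != 0 ->
    qpoch (c ^+ 2 / q ^+ l.+1) q l != 0 -> qpoch (- (q * a / c)) q l != 0 ->
    1 - q / c ^+ 2 != 0 -> qpoch (q / q ^+ l / a) q l != 0 ->
    qpoch (q ^+ (2 + l) / c ^+ 2) q l != 0 ->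
    qpoch (q ^+ m / q ^+ n.*2) q m != 0 ->
    (forall j, (j <= m)%N -> qpoch (q ^+ j / q ^+ n.*2.+1) q j != 0) ->
    qpoch q (q ^+ 2) n != 0 -> qpoch (d ^+ 2) (q ^+ 2) n != 0 ->
  \sum_(k < n.+1) qbin q n k * (-1) ^+ k * q ^+ 'C(k, 2) * q ^+ k / q ^+ (n * k)
      * (qpoch a q k * qpoch c q k * qpoch (- (q ^+ (1 + l) * E * a / c)) q k)
      / (qpoch d q k * qpoch (q * E * a) q k * qpoch (- (c / q ^+ n)) q k)
  = qpoch a q l * qpoch (- (c / q ^+ l)) q l
    / (qpoch (c ^+ 2 / q ^+ l.+1) q l * qpoch (- (q * a / c)) q l)
  * (qpoch (q * E) q n * qpoch (- (q * a / c)) q n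
    / (qpoch (q * E * a) q n * qpoch (- (q / c)) q n))
  * \sum_(i < l.+1) \sum_(j < m.+1) lcoef q a c l i * mcoef q m n j
     * (qpoch (q ^+ l / q ^+ i * a) q j * qpoch (q ^+ (1 + l + i) * a / c ^+ 2) q j
        / (qpoch d q j * qpoch (- d) q j))
     * (qpoch (q * (q ^+ l / q ^+ i * a * q ^+ j)) (q ^+ 2) (n - j)
        * qpoch (q * (q ^+ (1 + l + i) * a / c ^+ 2 * q ^+ j)) (q ^+ 2) (n - j)
        / (qpoch q (q ^+ 2) (n - j)
           * qpoch (d ^+ 2 * (q ^+ 2) ^+ j) (q ^+ 2) (n - j))).
Proof.
move=> E d q0 a0 c0 le_mn qn ql dn en fn hcl hal hc hia hic hm hj hq hw.
have ndn : qpoch (- d) q n != 0.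
  by move: hw; rewrite qpoch_sqr mulf_eq0 negb_or => /andP[].
(* As -d = (-qa/c) q^l, the products (-qa/c)_l and (-d)_n join to (-qa/c)_(l+n), which contains
   (-qa/c)_n. *)
have haln : qpoch (- (q * a / c)) q n != 0.
  have : qpoch (- (q * a / c)) q (l + n) != 0.
    rewrite qpochD mulf_neq0 // (_ : _ * q ^+ l = - d) //.
    by rewrite /d exprS; ring.
  by apply: qpoch_neq0W; rewrite leq_addl.
rewrite phi43_sears //.
set C0 := qpoch _ q n / _; set C1 := qpoch a q l * _ / _.
pose mu k := qbin q n k * (q * E) ^+ k * qpoch (- (q ^+ m / q ^+ n)) q k
      * qpoch (q * E) q (n - k).
pose u i := q ^+ l / q ^+ i * a; pose v i := q ^+ (1 + l + i) * a / c ^+ 2.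
(* The product is the same for every i, so one denominator (d^2; q^2)_k = (d)_k (-d)_k serves all
   inner sums. *)
have uv i : q * u i * v i = d ^+ 2.
  by rewrite /u /v /d !exprD expr1; field; rewrite c0 expf_neq0.
transitivity (C0 * C1 * \sum_(i < l.+1) lcoef q a c l i
   * \sum_(k < n.+1) mu k * (qpoch (u i) q k * qpoch (v i) q k / qpoch (q * u i * v i) (q ^+ 2) k)).
  rewrite -[C0 * C1 * _]mulrA; congr (_ * _).
  under [X in _ = _ * X]eq_bigr do rewrite mulr_sumr.
  rewrite exchange_big mulr_sumr; apply: eq_bigr => k _.
  have le_kn := leq_ord k; move: (nat_of_ord k) le_kn => {}k le_kn.
  have dk := qpoch_neq0W le_kn dn; have ndk := qpoch_neq0W le_kn ndn.
  have alk := qpoch_neq0W le_kn haln.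
  have HB := l_reduction q0 a0 c0 ql hcl hal alk hc hia hic.
  rewrite -/d -/C1 in HB.
  (* The inserted quotient (-d)_k / (-d)_k supplies the numerator factor for [l_reduction] and the
     second half of (d^2; q^2)_k. *)
  transitivity (mu k / (qpoch d q k * qpoch (- d) q k) *
     (qpoch a q k * qpoch (q ^+ (1 + l) * a / c ^+ 2) q k * qpoch (- d) q k / qpoch (- (q * a / c)) q k)).
    by rewrite /mu; field; rewrite dk ndk alk.
  rewrite HB !mulr_sumr; apply: eq_bigr => i _.
  by rewrite uv qpoch_sqr /u /v; ring.
transitivity (C1 * (C0 * qpoch (q * E) q n) * (\sum_(i < l.+1) \sum_(j < m.+1) lcoef q a c l i * mcoef q m n j
     * (qpoch (u i) q j * qpoch (v i) q j / (qpoch d q j * qpoch (- d) q j))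
     * (qpoch (q * (u i * q ^+ j)) (q ^+ 2) (n - j)
        * qpoch (q * (v i * q ^+ j)) (q ^+ 2) (n - j)
        / (qpoch q (q ^+ 2) (n - j)
           * qpoch (d ^+ 2 * (q ^+ 2) ^+ j) (q ^+ 2) (n - j))))); last first.
  by congr (_ * _ * _); rewrite /C0; ring.
set S := (X in _ = _ * X).
transitivity (C0 * C1 * (qpoch (q * E) q n * S)); last by ring.
congr (_ * _); rewrite /S mulr_sumr; apply: eq_bigr => i _.
rewrite /mu /E m_reduction ?uv // mulrCA -/E; congr (_ * _).
rewrite mulr_sumr; apply: eq_bigr => j _.
by rewrite qpoch_sqr; ring.
Qed.

(** * Integer exponents as quotients of natural powers, and the theorem *)

Lemma exprz_frac q (x y : nat) (z : int) :
  q != 0 -> z = x%:Z - y%:Z -> q ^ z = q ^+ x / q ^+ y.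
Proof. by move=> q0 ->; rewrite expfzDr // -exprnN. Qed.

Lemma Tterm_coef q a c (l m n i j : nat) : q != 0 ->
  let d := q ^+ (1 + l) * a / c in
  Tterm q a c l m n i j = lcoef q a c l i * mcoef q m n j
     * (qpoch (q ^+ l / q ^+ i * a) q j * qpoch (q ^+ (1 + l + i) * a / c ^+ 2) q j
        / (qpoch d q j * qpoch (- d) q j))
     * (qpoch (q * (q ^+ l / q ^+ i * a * q ^+ j)) (q ^+ 2) (n - j)
        * qpoch (q * (q ^+ (1 + l + i) * a / c ^+ 2 * q ^+ j)) (q ^+ 2) (n - j)
        / (qpoch q (q ^+ 2) (n - j)
           * qpoch (d ^+ 2 * (q ^+ 2) ^+ j) (q ^+ 2) (n - j))).
Proof.
move=> q0 d.
have qN (k : nat) : q ^ (- k%:Z) = (q ^+ k)^-1 by rewrite exprnN.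
have e1 : q ^ ((m%:Z - n%:Z) * j%:Z + 'C(j.+1, 2)%:Z)
    = q ^+ m ^+ j / q ^+ n ^+ j * q ^+ 'C(j.+1, 2).
  rewrite expfzDr // -exprz_exp expfzDr // qN; congr (_ * _).
  by rewrite -[LHS]/((q ^+ m / q ^+ n) ^+ j) exprMn exprVn.
have el1 : q ^ (1 - l%:Z) = q / q ^+ l by apply: (@exprz_frac _ 1).
have eli : q ^ (l%:Z - i%:Z) = q ^+ l / q ^+ i by apply: exprz_frac.
have emn : q ^ (m%:Z - 2 * n%:Z) = q ^+ m / q ^+ n.*2 by apply: exprz_frac => //; lia.
have ejn : q ^ (j%:Z - 2 * n%:Z - 1) = q ^+ j / q ^+ n.*2.+1.
  by apply: exprz_frac => //; lia.
have elij : q ^ (1 + l%:Z - i%:Z + j%:Z) * a = q * (q ^+ l / q ^+ i * a * q ^+ j).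
  rewrite (@exprz_frac _ (1 + l + j) i) //; last by lia.
  by rewrite !exprD expr1; ring.
have e2 : q ^+ (2 + l + i + j) * a / c ^+ 2 = q * (q ^+ (1 + l + i) * a / c ^+ 2 * q ^+ j).
  by rewrite -[(2 + l + i + j)%N]/(1 + (1 + l + i + j))%N !exprD expr1; ring.
have ew : q ^+ (2 + 2 * l + 2 * j) * a ^+ 2 / c ^+ 2 = d ^+ 2 * (q ^+ 2) ^+ j.
  rewrite (_ : (2 + 2 * l + 2 * j = (1 + l) + (1 + l) + (j + j))%N); last by lia.
  rewrite /d -exprM mul2n -addnn (exprD _ (1 + l + (1 + l))) (exprD _ (1 + l)) -exprVn; ring.
rewrite /Tterm /qpochs !(big_cons, big_nil) !mulr1 e1 el1 eli emn ejn elij e2 ew !qN -/d.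
by rewrite /lcoef /mcoef !invfM; ring.
Qed.

End QSeriesTheory.

Theorem mainTheorem8 (R : realType) (q a c : R[i]) (l m n : nat)
  (q_neq0 : q != 0) (a_neq0 : a != 0) (c_neq0 : c != 0) (le_mn : (m <= n)%N)
  (* no zero factor in a denominator of the left-hand side *)
  (den_phi : forall k : nat, (k <= n)%N ->
    qpochs [:: q; q ^+ (1 + l) * a / c; q ^ (1 - m%:Z + n%:Z) * a;
               - (q ^ (- n%:Z) * c)] q k != 0)
  (* no zero factor in a denominator of the prefactor *)
  (den_l : qpochs [:: q ^ (- l%:Z - 1) * c ^+ 2; - (q * a / c)] q l != 0)
  (den_n : qpochs [:: q ^ (1 - m%:Z + n%:Z) * a; - (q / c)] q n != 0)
  (* no zero factor in a denominator of the terms of the double sum *)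
  (den_c : 1 - q / c ^+ 2 != 0)
  (den_i : forall i : nat, (i <= l)%N ->
    qpochs [:: q; q ^ (1 - l%:Z) / a; q ^+ (2 + l) / c ^+ 2] q i != 0)
  (den_j : forall j : nat, (j <= m)%N ->
    qpochs [:: q; q ^+ (1 + l) * a / c; - (q ^+ (1 + l) * a / c);
               q ^ (m%:Z - 2 * n%:Z); q ^ (j%:Z - 2 * n%:Z - 1)] q j != 0)
  (den_nj : forall j : nat, (j <= m)%N ->
    qpochs [:: q; q ^+ (2 + 2 * l + 2 * j) * a ^+ 2 / c ^+ 2]
           (q ^+ 2) (n - j) != 0) :
  phi43 n a c (q ^ (- n%:Z)) (- (q ^ (1 + l%:Z - m%:Z + n%:Z) * a / c))
    (q ^+ (1 + l) * a / c) (q ^ (1 - m%:Z + n%:Z) * a) (- (q ^ (- n%:Z) * c))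
    q q
  = qpochs [:: a; - (q ^ (- l%:Z) * c)] q l
      / qpochs [:: q ^ (- l%:Z - 1) * c ^+ 2; - (q * a / c)] q l
    * (qpochs [:: q ^ (1 - m%:Z + n%:Z); - (q * a / c)] q n
       / qpochs [:: q ^ (1 - m%:Z + n%:Z) * a; - (q / c)] q n)
    * \sum_(i < l.+1) \sum_(j < m.+1) Tterm q a c l m n i j.
Proof.
have qN (k : nat) : q ^ (- k%:Z) = (q ^+ k)^-1 by rewrite exprnN.
have eE : q ^ (1 - m%:Z + n%:Z) = q * (q ^+ n / q ^+ m).
  by rewrite mulrA -exprS; apply: exprz_frac => //; lia.
have el1 : q ^ (1 - l%:Z) = q / q ^+ l by apply: (@exprz_frac _ _ 1).
have ell : q ^ (- l%:Z - 1) = (q ^+ l.+1)^-1.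
  by rewrite -[RHS]mul1r; apply: (@exprz_frac _ _ 0) => //; lia.
have es : q ^ (1 + l%:Z - m%:Z + n%:Z) = q ^+ (1 + l) * (q ^+ n / q ^+ m).
  by rewrite mulrA -exprD; apply: exprz_frac => //; lia.
have emn : q ^ (m%:Z - 2 * n%:Z) = q ^+ m / q ^+ n.*2 by apply: exprz_frac => //; lia.
have ejn (j : nat) : q ^ (j%:Z - 2 * n%:Z - 1) = q ^+ j / q ^+ n.*2.+1.
  by apply: exprz_frac => //; lia.
rewrite !(eE, ell, qN, es) /qpochs !(big_cons, big_nil) !mulr1 in den_phi den_l den_n *.
rewrite !(mulrC _^-1 (c ^+ _)) !(mulrC _^-1 c) in den_phi den_l *.
(* A longer product contains the shorter ones, so the instance k = n covers all k <= n; likewise i =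
   l below. *)
have := den_phi n (leqnn n); rewrite !(big_cons, big_nil) mulr1 !mulf_eq0 !negb_or => /and4P[qn dn en fn].
have := den_i l (leqnn l).
rewrite el1 /qpochs !(big_cons, big_nil) mulr1 !mulf_eq0 !negb_or => /and3P[ql hia hic].
have := den_j m (leqnn m).
rewrite emn /qpochs !(big_cons, big_nil) mulr1 !mulf_eq0 !negb_or => /and5P[_ _ _ hm _].
(* Here the base q^(j-2n-1) moves with j, so every j is kept. *)
have hj (j : nat) : (j <= m)%N -> qpoch (q ^+ j / q ^+ n.*2.+1) q j != 0.
  move=> /den_j; rewrite ejn /qpochs !(big_cons, big_nil) mulr1 !mulf_eq0 !negb_or.
  by case/and5P.
(* At j = 0 the products to base q^2 reach their full length n. *)
have := den_nj 0 isT.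
rewrite /qpochs !(big_cons, big_nil) mulr1 !mulf_eq0 !negb_or muln0 addn0 subn0 => /andP[hq hw].
move: den_l; rewrite mulf_eq0 negb_or => /andP[hcl hal].
have hw' : qpoch ((q ^+ (1 + l) * a / c) ^+ 2) (q ^+ 2) n != 0.
  move: hw; congr (qpoch _ _ _ != 0).
  rewrite (_ : (2 + 2 * l = (1 + l) + (1 + l))%N); last by clear; lia.
  by rewrite (exprD _ (1 + l)) -exprVn; ring.
under [\sum_(i < l.+1) _]eq_bigr => i _ do under eq_bigr => j _ do rewrite Tterm_coef //.
rewrite -(@phi43_double_sum _ q a c l m n) //.
rewrite /phi43 /qpochs; apply: eq_bigr => k _.
rewrite !(big_cons, big_nil) !mulr1.
have le_kn : (k <= n)%N by rewrite -ltnS.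
have H := qbin_qpoch q_neq0 qn le_kn.
set x := qpoch (q ^+ n)^-1 q k in H *; set y := qpoch q q k in H *.
transitivity (x / y * (qpoch a q k * qpoch c q k
    * qpoch (- (q ^+ (1 + l) * (q ^+ n / q ^+ m) * a / c)) q k
    / (qpoch (q ^+ (1 + l) * a / c) q k * qpoch (q * (q ^+ n / q ^+ m) * a) q k
       * qpoch (- (c / q ^+ n)) q k) * q ^+ k)); first by rewrite !invfM; ring.
by rewrite H; ring.
Qed.
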